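(* Consider the system $$\dot u = L_0(u)+\varepsilon F(u)+\mathcal O(\varepsilon^2),\qquad u=(z,\psi,w)\in X=\mathbb C\times\mathbb S^1\times\mathbb R,\qquad 0<\varepsilon\ll 1,$$ with $L_0(z,\psi,w)=(i\omega_0 z,\Omega_0,0)$, and suppose that each component $F_j$, $j\in\{z,\psi,w\}$, admits a finite Fourier--Taylor expansion $$F_j(u)=\sum_{\alpha\in\mathcal A} f_j^\alpha M_\alpha(u),$$ where only finitely many coefficients $f_j^\alpha\in\mathbb C$ are nonzero. Then there exists a near-identity transformation of the form $\bar u=u+\varepsilon H(u)+\mathcal O(\varepsilon^2)$ under which the system becomes $$\dot{\bar u}=L_0(\bar u)+\varepsilon\,\bar F(\bar u)+\mathcal O(\varepsilon^2),$$ where $\bar F$ is the resonant projection of $F$, i.e. $$\bar F_j(u)=\sum_{\alpha\in\Lambda_j^{\mathcal R}} f_j^\alpha M_\alpha(u),\qquad j\in\{z,\psi,w\}.$$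
   Context: Here $\omega_0>0$ and $\Omega_0\in\mathbb R$ are constants. Vector fields on $X=\mathbb C\times\mathbb S^1\times\mathbb R$ ($\mathbb S^1=\mathbb R/2\pi\mathbb Z$) are written in components $F=(F_z,F_\psi,F_w)$, with $F_z$ complex-valued and $F_\psi,F_w$ real-valued; correspondingly, for $j\in\{\psi,w\}$ the coefficients satisfy $f_j^{(b,a,-k,c)}=\overline{f_j^{(a,b,k,c)}}$. Index set and monomials: $\mathcal A=\mathbb N_0\times\mathbb N_0\times\mathbb Z\times\mathbb N_0$, and for $\alpha=(a,b,k,c)\in\mathcal A$, $M_\alpha(z,\psi,w)=z^a\bar z^b e^{ik\psi}w^c$. Homological eigenvalues: for $\alpha=(a,b,k,c)$, $\lambda_\alpha^{(z)}=(a-b-1)\omega_0+k\Omega_0$ and $\lambda_\alpha^{(\psi)}=\lambda_\alpha^{(w)}=(a-b)\omega_0+k\Omega_0$. Resonant index sets: $\Lambda_j^{\mathcal R}=\{\alpha\in\mathcal A:\lambda_\alpha^{(j)}=0\}$ for $j\in\{z,\psi,w\}$. The terms $\mathcal O(\varepsilon^2)$ denote $\varepsilon$-dependent remainders bounded by a constant times $\varepsilon^2$ as $\varepsilon\to0^+$, uniformly for $u$ in compact subsets of $X$. A near-identity transformation is an $\varepsilon$-dependent smooth change of coordinates, defined and invertible on any given compact set for all sufficiently small $\varepsilon$, of the indicated form, with $H$ a smooth vector field on $X$. *)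

(* Defs.v *)
From mathcomp Require Import all_boot all_order all_algebra.
From mathcomp Require Import complex.
From mathcomp Require Import all_classical all_reals all_analysis.

Set Implicit Arguments.
Unset Strict Implicit.
Unset Printing Implicit Defensive.

Import Order.TTheory GRing.Theory Num.Theory.
Import numFieldNormedType.Exports.

Local Open Scope classical_set_scope.
Local Open Scope complex_scope.
Local Open Scope ring_scope.

(* The phase space X = C x S^1 x R is handled on its covering space
   C x R x R: an element ((x, y), psi, w) has z = x + i y, and psi is an angle
   lifted from S^1 = R / 2 pi Z.  C is spelled R * R because R[i] carries no
   normedModType structure over R.  Tangent vectors have the same type. *)
Definition phase (R : realType) : normedModType R := ((R * R) * R * R)%type.

Definition mk_phase (R : realType) (z : R[i]) (psi w : R) : phase R :=
  ((complex.Re z, complex.Im z), psi, w).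

Definition z_of (R : realType) (u : phase R) : R[i] := u.1.1.1 +i* u.1.1.2.
Definition psi_of (R : realType) (u : phase R) : R := u.1.2.
Definition w_of (R : realType) (u : phase R) : R := u.2.

Inductive component := Cz | Cpsi | Cw.

Definition component_of (R : realType) (j : component) (v : phase R) : R[i] :=
  match j with
  | Cz => z_of v
  | Cpsi => (psi_of v)%:C
  | Cw => (w_of v)%:C
  end.

(* The deck transformation psi |-> psi + 2 pi of the covering of X. *)
Definition deck (R : realType) (u : phase R) : phase R :=
  mk_phase (z_of u) (psi_of u + 2 * pi) (w_of u).

(* Vector fields on X are the 2 pi-periodic (in psi) ones on the covering space. *)
Definition psi_periodic (R : realType) (G : phase R -> phase R) : Prop :=
  forall u, G (deck u) = G u.

(* (a, b, k, c) *)
Definition multi_index : Type := (nat * nat * int * nat)%type.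

Definition expi (R : realType) (t : R) : R[i] := cos t +i* sin t.

Definition monomial (R : realType) (alpha : multi_index) (u : phase R)
    : R[i] :=
  let: (a, b, k, c) := alpha in
  z_of u ^+ a * conjc (z_of u) ^+ b * expi (k%:~R * psi_of u)
    * (w_of u)%:C ^+ c.

Definition homological_eigenvalue (R : realType) (omega0 Omega0 : R)
    (j : component) (alpha : multi_index) : R :=
  let: (a, b, k, _) := alpha in
  match j with
  | Cz => (a%:R - b%:R - 1) * omega0 + k%:~R * Omega0
  | Cpsi | Cw => (a%:R - b%:R) * omega0 + k%:~R * Omega0
  end.

Definition resonant (R : realType) (omega0 Omega0 : R) (j : component) :
    set multi_index :=
  [set alpha | homological_eigenvalue omega0 Omega0 j alpha = 0].

(* F_j = \sum_(alpha in D j) f_j^alpha M_alpha for every j.  The sum is the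
   finitely supported one, which is 0 by convention on infinite supports: it is
   meaningful when f_j has finite support. *)
Definition has_expansion (R : realType) (D : component -> set multi_index)
    (f : component -> multi_index -> R[i]) (F : phase R -> phase R) : Prop :=
  forall j u, component_of j (F u) =
    \sum_(alpha \in D j) (f j alpha * monomial alpha u).

Definition real_coefficients (R : realType) (g : multi_index -> R[i]) : Prop :=
  forall a b k c, g (b, a, - k, c) = conjc (g (a, b, k, c)).

Definition L0 (R : realType) (omega0 Omega0 : R) (u : phase R) : phase R :=
  mk_phase ((0 +i* omega0) * z_of u) Omega0 0.

(* g(e, u) = O(e^2) as e -> 0+, uniformly for u in compact sets.  Every compact
   subset of X is the image of a compact subset of the covering space, so for
   psi_periodic g this is uniformity on the compact subsets of X. *)
Definition O_eps2 (R : realType) (g : R -> phase R -> phase R) : Prop :=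
  forall K : set (phase R), compact K ->
    exists C : R, \forall e \near (0 : R)^'+,
      forall u, K u -> `|g e u| <= C * e ^+ 2.

(* C^n and C^oo maps on an open subset U of a finite-dimensional space. *)
Fixpoint C_n (R : realType) (V W : normedModType R) (n : nat) (U : set V)
    (f : V -> W) : Prop :=
  match n with
  | 0 => forall x, U x -> {for x, continuous f}
  | m.+1 => (forall x, U x -> differentiable f x) /\
            (forall v, C_n m U (fun x => 'D_v f x))
  end.

Definition smooth (R : realType) (V W : normedModType R) (U : set V)
    (f : V -> W) : Prop :=
  forall n, C_n n U f.

(* Phi and Psi are mutually inverse smooth maps between U and W.  The last two
   fields say that they descend to mutually inverse diffeomorphisms between the
   images of U and W in X; the same properties of W and Psi follow. *)
Record diffeo (R : realType) (U W : set (phase R))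
    (Phi Psi : phase R -> phase R) : Prop := Diffeo {
  diffeo_openU : open U;
  diffeo_openW : open W;
  diffeo_to : forall u, U u -> W (Phi u) /\ Psi (Phi u) = u;
  diffeo_from : forall v, W v -> U (Psi v) /\ Phi (Psi v) = v;
  diffeo_smooth : smooth U Phi;
  diffeo_smooth_inv : smooth W Psi;
  diffeo_deckU : forall u, U (deck u) <-> U u;
  diffeo_deck : forall u, U u -> Phi (deck u) = deck (Phi u)
}.

Definition exhausts (R : realType) (U : R -> set (phase R)) : Prop :=
  forall K : set (phase R), compact K ->
    \forall e \near (0 : R)^'+, K `<=` U e.

(* ubar = Phi_e(u) = u + e H(u) + O(e^2), a change of coordinates from U_e onto
   W_e with inverse Psi_e, where both U_e and W_e contain any given compact set
   once e > 0 is small enough. *)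
Record near_identity (R : realType) (H : phase R -> phase R)
    (U W : R -> set (phase R)) (Phi Psi : R -> phase R -> phase R) : Prop :=
  NearIdentity {
  ni_periodic : psi_periodic H;
  ni_smooth : smooth setT H;
  ni_diffeo : \forall e \near (0 : R)^'+, diffeo (U e) (W e) (Phi e) (Psi e);
  ni_exhaustsU : exhausts U;
  ni_exhaustsW : exhausts W;
  ni_form : O_eps2 (fun e u => Phi e u - (u + e *: H u))
}.

(* The vector field of the system u' = V(u) in the coordinates ubar = Phi(u):
   ubar' = DPhi(u) V(u) with u = Psi(ubar). *)
Definition pushforward_field (R : realType) (Phi Psi V : phase R -> phase R)
    (ubar : phase R) : phase R :=
  'd Phi (Psi ubar) (V (Psi ubar)).

(* Main.v *)
Require Import Defs.
From HB Require Import structures.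
From mathcomp Require Import all_boot all_order all_algebra.
From mathcomp Require Import complex ring lra.
From mathcomp Require Import all_classical all_reals all_analysis.

Import Order.TTheory GRing.Theory Num.Theory.
Import numFieldNormedType.Exports.

Local Open Scope classical_set_scope.
Local Open Scope complex_scope.
Local Open Scope ring_scope.

(** Take Phi_e = id + e H exactly, where H solves the homological equation
    F + dH(L0) - dL0(H) = Fbar; the e-terms of the transformed field then cancel.
    A monomial M_alpha is an eigenfunction of differentiation along L0, with
    eigenvalue i lambda_alpha^(psi), so H is found coefficientwise by dividing
    by -i lambda_alpha^(j) off resonance.

    H and its Lipschitz constant are bounded on each strip |Re z|, |Im z|, |w| <= r.
    Precomposing H with the clamping of x, y, w to [-r, r] makes id + e H a global
    bijection for small e, by Banach's fixed point theorem.  Letting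
    r = r(e) tend to infinity slowly as e -> 0 gives exhausting domains on which
    this bijection is Phi_e.  Its inverse is smooth because the inverse of the
    Jacobian matrix has smooth entries (Cramer). *)

Set Implicit Arguments.
Unset Strict Implicit.

(** * Calculus of C^n maps *)

Section Calculus.
Context {R : realType} {V : normedModType R}.

(** The obstacle is the polynomial growth of H in z and w: id + e H need not be injective or onto on
    all of X, and its Lipschitz constant is controlled only where x, y and w are bounded. The angle
    may stay unbounded, because H sees it only through cos and sin of k psi; bounding it would
    destroy the invariance of the domains under the deck transformation. The threshold 1/2 for
    [e * L] does two jobs: the perturbation becomes a contraction, and it moves every point by at
    most 1/2, so preimages of a compact set stay in one fixed ball while the domains grow. Finite
    support leaves finitely many divisions by nonzero eigenvalues, so no small-divisor estimate
    arises. As Phi_e is exactly id + e H and L0 is affine, the error in the transformed field is an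
    explicit sum of four terms, each estimated separately. *)

Lemma is_diff_of_norm (W : normedModType R) (f : V -> W) (L : {linear V -> W})
    (x : V) : continuous L ->
  (forall eps, 0 < eps ->
    \forall h \near 0, `|f (h + x) - f x - L h| <= eps * `|h|) ->
  is_diff x f L.
Proof.
move=> Lc fL.
have E : f \o shift x = cst (f x) + L +o_ 0 id.
  by apply/eqaddoP => eps /fL; apply: filterS => h; rewrite !fctE /= opprD addrA.
have dE := diff_unique Lc E.
by split=> //; apply/diff_locallyP; rewrite dE.
Qed.

Lemma differentiable_norm {W : normedModType R} {f : V -> W} {x : V} :
  differentiable f x -> forall eps, 0 < eps ->
  \forall h \near 0, `|f (h + x) - f x - 'd f x h| <= eps * `|h|.
Proof.
move=> /diff_locally /eqaddoP fL eps /fL.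
by apply: filterS => h; rewrite !fctE /= opprD addrA.
Qed.

Lemma near_eq_is_diff (W : normedModType R) (f g : V -> W) (x : V) :
  (\near x, f x = g x) -> differentiable f x -> is_diff x g ('d f x).
Proof.
move=> fg df; apply: is_diff_of_norm; first exact: diff_continuous.
move=> eps eps0; have fgx : f x = g x by exact: nbhs_singleton fg.
have fgs : \forall h \near 0, f (h + x) = g (h + x).
  by move: fg; rewrite (near_shift 0) subr0.
near=> h; rewrite -fgx -(near fgs h)//.
by near: h; exact: differentiable_norm.
Unshelve. all: by end_near.
Qed.

(** Openness turns agreement on [U] into agreement near each of its points, which is what a
    derivative sees. The closure lemmas below use this to replace a directional derivative by a
    formula valid only on [U]. *)
Lemma C_n_ext (W : normedModType R) n (U : set V) (f g : V -> W) : open U ->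
  (forall x, U x -> f x = g x) -> C_n n U f -> C_n n U g.
Proof.
move=> oU; elim: n f g => [|n IH] f g fg /= => [fc x Ux|[df Df]].
  have fgx : \near x, f x = g x.
    by apply: filterS (open_nbhs_nbhs (conj oU Ux)).
  have gf : g @ x --> f @ x.
    by apply: near_eq_cvg; apply: filterS fgx => y ->.
  have fcx : f @ x --> f x by exact: (fc x Ux).
  by have := cvg_trans gf fcx; rewrite (fg x Ux).
have near_fg x : U x -> \near x, f x = g x.
  by move=> Ux; apply: filterS (open_nbhs_nbhs (conj oU Ux)).
split=> [x Ux|v].
  by have [] := near_eq_is_diff (near_fg x Ux) (df x Ux).
by apply: IH (Df v) => x Ux; apply: near_eq_derive; exact: near_fg.
Qed.

Lemma C_n_le (W : normedModType R) n (U : set V) (f : V -> W) :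
  C_n n.+1 U f -> C_n n U f.
Proof.
elim: n f => [|n IH] f [df Df].
  by move=> x Ux; exact: differentiable_continuous (df x Ux).
by split=> // v; exact: IH.
Qed.

Lemma C_n_sub (W : normedModType R) n (U U' : set V) (f : V -> W) :
  U' `<=` U -> C_n n U f -> C_n n U' f.
Proof.
move=> UU; elim: n f => [|n IH] f; first by move=> fc x /UU; exact: fc.
by move=> [df Df]; split=> [x /UU|v]; [exact: df|exact/IH/Df].
Qed.

Lemma C_n_cst (W : normedModType R) n (U : set V) (a : W) :
  C_n n U (fun _ => a).
Proof.
elim: n a => [|n IH] a /=; first by move=> x _; exact: cst_continuous.
split=> [x _|v]; first exact: differentiable_cst.
have -> : 'D_v (fun=> a) = fun=> 0 by apply/funext => x; exact: derive_cst.
exact: IH.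
Qed.

Lemma C_nD (W : normedModType R) n (U : set V) (f g : V -> W) : open U ->
  C_n n U f -> C_n n U g -> C_n n U (fun x => f x + g x).
Proof.
move=> oU; elim: n f g => [|n IH] f g /=.
  by move=> fc gc x Ux; apply: (@cvgD _ W V); [exact: fc|exact: gc].
move=> [df Df] [dg Dg]; split=> [x Ux|v].
  by apply: differentiableD; [exact: df|exact: dg].
apply: C_n_ext (IH _ _ (Df v) (Dg v)) => // x Ux.
by rewrite -deriveD//; apply: diff_derivable; [exact: df|exact: dg].
Qed.

(** The product rule returns [f] and [g] undifferentiated, so the induction also needs them one
    class lower, through [C_n_le]. *)
Lemma C_nM n (U : set V) (f g : V -> R) : open U ->
  C_n n U f -> C_n n U g -> C_n n U (fun x => f x * g x).
Proof.
move=> oU; elim: n f g => [|n IH] f g.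
  by move=> fc gc x Ux; apply: cvgM; [exact: fc|exact: gc].
move=> fn gn; have [df Df] := fn; have [dg Dg] := gn; split=> [x Ux|v].
  by apply: differentiableM; [exact: df|exact: dg].
have := C_nD oU (IH _ _ (C_n_le fn) (Dg v)) (IH _ _ (C_n_le gn) (Df v)).
apply: C_n_ext => // x Ux.
by rewrite deriveM//; apply: diff_derivable; [exact: df|exact: dg].
Qed.

Lemma C_nV n (U : set V) (f : V -> R) : open U -> (forall x, U x -> f x != 0) ->
  C_n n U f -> C_n n U (fun x => (f x)^-1).
Proof.
move=> oU f0; elim: n f f0 => [|n IH] f f0.
  by move=> fc x Ux; apply: cvgV; [exact: f0|exact: fc].
move=> fn; have [df Df] := fn; split=> [x Ux|v].
  by apply: differentiableV; [exact: df|exact: f0].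
have fVn := IH _ f0 (C_n_le fn).
(* The derivative is -(1/f)^2 D_v f, a product in which 1/f reappears one class lower. *)
have := C_nM oU (C_n_cst n U (-1 : R)) (C_nM oU (C_nM oU fVn fVn) (Df v)).
apply: C_n_ext => // x Ux.
rewrite (@deriveV _ _ f) ?f0//; last by apply: diff_derivable; exact: df.
by rewrite mulN1r scaleNr /GRing.scale /= expr2 invfM.
Qed.

Lemma C_n_sum (W : normedModType R) n (U : set V) (I : Type) (r : seq I)
    (P : pred I) (f : I -> V -> W) : open U ->
  (forall i, C_n n U (f i)) -> C_n n U (fun x => \sum_(i <- r | P i) f i x).
Proof.
move=> oU fn; elim: r => [|i r IH].
  by apply: C_n_ext (C_n_cst n U (0 : W)) => // x _; rewrite big_nil.
case Pi: (P i).
  by apply: C_n_ext (C_nD oU (fn i) IH) => // x _; rewrite big_cons Pi.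
by apply: C_n_ext IH => // x _; rewrite big_cons Pi.
Qed.

Lemma C_n_prod n (U : set V) (I : Type) (r : seq I)
    (P : pred I) (f : I -> V -> R) : open U ->
  (forall i, C_n n U (f i)) -> C_n n U (fun x => \prod_(i <- r | P i) f i x).
Proof.
move=> oU fn; elim: r => [|i r IH].
  by apply: C_n_ext (C_n_cst n U (1 : R)) => // x _; rewrite big_nil.
case Pi: (P i).
  by apply: C_n_ext (C_nM oU (fn i) IH) => // x _; rewrite big_cons Pi.
by apply: C_n_ext IH => // x _; rewrite big_cons Pi.
Qed.

Lemma derive_lin (W : normedModType R) (L : {linear V -> W}) (v x : V) :
  continuous L -> 'D_v L x = L v.
Proof.
move=> Lc; rewrite deriveE ?diff_lin//.
by apply: linear_differentiable.
Qed.

Lemma C_n_lin (W : normedModType R) n (U : set V) (L : {linear V -> W}) :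
  continuous L -> C_n n U L.
Proof.
move=> Lc; case: n => [|n] /=; first by move=> x _; exact: Lc.
split=> [x _|v]; first exact: linear_differentiable.
have -> : 'D_v L = fun=> L v by apply/funext => x; exact: derive_lin.
exact: C_n_cst.
Qed.

Lemma C_n_lin_comp (W W' : normedModType R) n (U : set V) (f : V -> W)
    (L : {linear W -> W'}) : open U -> continuous L ->
  C_n n U f -> C_n n U (fun x => L (f x)).
Proof.
move=> oU Lc; elim: n f => [|n IH] f.
  by move=> fc x Ux; apply: continuous_comp; [exact: fc|exact: Lc].
move=> [df Df]; split=> [x Ux|v].
  by apply: differentiable_comp; [exact: df|exact: linear_differentiable].
apply: C_n_ext (IH _ (Df v)) => // x Ux.
rewrite [RHS]deriveE ?(diff_comp (df x Ux))//=.
- by rewrite diff_lin// deriveE//; exact: df.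
- exact: linear_differentiable.
- by apply: differentiable_comp; [exact: df|exact: linear_differentiable].
Qed.

Lemma C_n_pair (W W' : normedModType R) n (U : set V) (f : V -> W)
    (g : V -> W') : open U -> C_n n U f -> C_n n U g ->
  C_n n U (fun x => (f x, g x)).
Proof.
move=> oU; elim: n f g => [|n IH] f g.
  by move=> fc gc x Ux; apply: cvg_pair; [exact: fc|exact: gc].
move=> [df Df] [dg Dg]; split=> [x Ux|v].
  by apply: differentiable_pair; [exact: df|exact: dg].
apply: C_n_ext (IH _ _ (Df v) (Dg v)) => // x Ux.
have [dfx dgx] := (df x Ux, dg x Ux).
rewrite [RHS]deriveE; last exact: differentiable_pair.
by rewrite diff_pair//= !deriveE.
Qed.

Lemma is_derive_comp1 (phi : R -> R) (f : V -> R) x v d : differentiable f x ->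
  is_derive (f x) 1 phi d ->
  is_derive x v (fun y => phi (f y)) (d * 'D_v f x).
Proof.
move=> df [dphi phid].
have dphi' : differentiable phi (f x) by exact/derivable1_diffP.
have dc : differentiable (phi \o f) x by exact: differentiable_comp.
split; first exact: (diff_derivable (f := phi \o f)).
rewrite (deriveE _ dc) (diff_comp df dphi')/= deriv1E// derive1E phid.
by rewrite (deriveE _ df) mulrC.
Qed.

(** Both functions go through one induction, since the derivative of each involves the other. *)
Lemma C_n_trigo n (U : set V) (f : V -> R) : open U -> C_n n U f ->
  C_n n U (fun x => cos (f x)) /\ C_n n U (fun x => sin (f x)).
Proof.
move=> oU; elim: n f => [|n IH] f fn.
  by split=> x Ux; apply: continuous_comp;
    [exact: fn|exact: continuous_cos|exact: fn|exact: continuous_sin].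
have [df Df] := fn; have [cn sn] := IH _ (C_n_le fn).
have dcomp (g dg : R -> R) : (forall t : R, is_derive t 1 g (dg t)) ->
    C_n n U (fun x => dg (f x)) -> C_n n.+1 U (fun x => g (f x)).
  move=> gdg dgn; split=> [x Ux|v].
    apply: differentiable_comp; first exact: df.
    by apply/derivable1_diffP; have [] := gdg (f x).
  apply: C_n_ext (C_nM oU dgn (Df v)) => // x Ux.
  by have [_ ->] := is_derive_comp1 v (df x Ux) (gdg (f x)).
split; last exact: dcomp cn.
apply: (dcomp _ (fun t => - sin t)).
apply: C_n_ext (C_nM oU (C_n_cst n U (-1 : R)) sn) => // x _.
by rewrite mulN1r.
Qed.

End Calculus.

(** * Coordinates on the phase space and inverse maps *)

Section ProductComplete.
Context {R : realType} (U V : completeNormedModType R).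
Let UV : normedModType R := (U * V)%type.

(** Banach's fixed point theorem will be applied on [phase R], an iterated product, which must
    therefore be a complete space. *)
Lemma prod_complete (F : set_system UV) :
  ProperFilter F -> cauchy F -> cvg F.
Proof.
move=> FF /cauchy_ballP Fc.
have /cauchy_cvg /cvg_ex[u Fu] : cauchy (fst @ F).
  apply/cauchy_ballP => e e0; rewrite near_map2.
  by apply: filterS (Fc _ e0) => -[x y] [].
have /cauchy_cvg /cvg_ex[v Fv] : cauchy (snd @ F).
  apply/cauchy_ballP => e e0; rewrite near_map2.
  by apply: filterS (Fc _ e0) => -[x y] [].
apply/cvg_ex; exists (u, v); apply/cvg_ballP => e e0.
move/cvg_ballP : Fu => /(_ _ e0) Fu; move/cvg_ballP : Fv => /(_ _ e0) Fv.
by near=> p; split=> /=; near: p.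
Unshelve. all: by end_near. Qed.

HB.instance Definition _ := Uniform_isComplete.Build (U * V)%type prod_complete.

End ProductComplete.

Section Coordinates.
Context {R : realType}.

(** Indexing the real coordinates by ['I_4] makes differentials into 4 x 4 matrices and reduces
    vector identities to real ones. *)
Definition pcoord (i : 'I_4) (u : phase R) : R :=
  tnth [tuple u.1.1.1; u.1.1.2; u.1.2; u.2] i.

Definition of_coords (t : 'I_4 -> R) : phase R :=
  ((t (inord 0), t (inord 1)), t (inord 2), t (inord 3)).

Lemma ord4P (P : 'I_4 -> Prop) : P (inord 0) -> P (inord 1) -> P (inord 2) ->
  P (inord 3) -> forall i, P i.
Proof.
move=> P0 P1 P2 P3 i; rewrite -(inord_val i).
by case: i => -[|[|[|[|]]]].
Qed.

Lemma pcoord0 u : pcoord (inord 0) u = u.1.1.1.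
Proof. by rewrite /pcoord (tnth_nth 0) inordK. Qed.
Lemma pcoord1 u : pcoord (inord 1) u = u.1.1.2.
Proof. by rewrite /pcoord (tnth_nth 0) inordK. Qed.
Lemma pcoord2 u : pcoord (inord 2) u = u.1.2.
Proof. by rewrite /pcoord (tnth_nth 0) inordK. Qed.
Lemma pcoord3 u : pcoord (inord 3) u = u.2.
Proof. by rewrite /pcoord (tnth_nth 0) inordK. Qed.

Definition pcoordE := (pcoord0, pcoord1, pcoord2, pcoord3).

Lemma of_coordsK t i : pcoord i (of_coords t) = t i.
Proof. by move: i; apply: ord4P; rewrite pcoordE. Qed.

Lemma pcoordK u : of_coords (pcoord^~ u) = u.
Proof. by case: u => -[[x y] p] w; rewrite /of_coords !pcoordE. Qed.

Lemma pcoord_inj u v : (forall i, pcoord i u = pcoord i v) -> u = v.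
Proof.
by move=> uv; rewrite -(pcoordK u) -(pcoordK v); congr of_coords; exact/funext.
Qed.

Lemma pcoord_is_linear i : linear (pcoord i).
Proof.
by move: i; apply: ord4P => k u v;
  [rewrite !pcoord0|rewrite !pcoord1|rewrite !pcoord2|rewrite !pcoord3].
Qed.

HB.instance Definition _ i :=
  GRing.isLinear.Build R (phase R) R _ (pcoord i) (pcoord_is_linear i).

Lemma norm_pcoord i u : `|pcoord i u| <= `|u|.
Proof.
by move: i; apply: ord4P; rewrite pcoordE !prod_normE !le_max lexx ?orbT.
Qed.

Lemma phase_norm_le u C : (forall i, `|pcoord i u| <= C) -> `|u| <= C.
Proof.
move=> uC; rewrite !prod_normE !ge_max.
by rewrite -pcoord0 -pcoord1 -pcoord2 -pcoord3 !uC.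
Qed.

Lemma pcoord_continuous i : continuous (pcoord i).
Proof.
apply: bounded_linear_continuous; apply/bounded_funP => r.
by exists r => u; apply: le_trans; exact: norm_pcoord.
Qed.

Definition basis (i : 'I_4) : phase R := of_coords (fun j => (i == j)%:R).

Lemma basisE (u : phase R) : u = \sum_i pcoord i u *: basis i.
Proof.
apply: pcoord_inj => j; rewrite linear_sum/= (bigD1 j)//= big1.
  by rewrite linearZ/= of_coordsK eqxx addr0 /GRing.scale/= mulr1.
by move=> i ij; rewrite linearZ/= of_coordsK (negPf ij) scaler0.
Qed.

Lemma C_n_coord (V : normedModType R) n (U : set V) (f : V -> phase R) i :
  open U -> C_n n U f -> C_n n U (fun x => pcoord i (f x)).
Proof. by move=> oU; apply: C_n_lin_comp => //; exact: pcoord_continuous. Qed.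

Lemma C_n_coords (V : normedModType R) n (U : set V) (t : V -> 'I_4 -> R) :
  open U -> (forall i, C_n n U (t^~ i)) -> C_n n U (fun x => of_coords (t x)).
Proof.
move=> oU tn; apply: (C_n_pair oU); last exact: tn.
by apply: (C_n_pair oU); [apply: (C_n_pair oU)|]; exact: tn.
Qed.

Lemma derive_basis (V : normedModType R) (f : phase R -> V) u v :
  differentiable f u -> 'd f u v = \sum_i pcoord i v *: 'D_(basis i) f u.
Proof.
move=> df; rewrite {1}(basisE v) linear_sum; apply: eq_bigr => i _.
by rewrite linearZ deriveE.
Qed.

(** [C_n] differentiates in fixed directions, whereas the chain rule differentiates [g] in the
    moving direction D_v Psi. Expanding that direction in the basis gives a finite sum of products
    (D_v Psi)_i * (D_i g o Psi), to which the induction applies. *)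
Lemma C_n_comp n (U W : set (phase R)) (g : phase R -> R)
    (Psi : phase R -> phase R) : open U -> open W ->
  (forall v, W v -> U (Psi v)) -> C_n n U g -> C_n n W Psi ->
  C_n n W (fun v => g (Psi v)).
Proof.
move=> oU oW WU; elim: n g => [|n IH] g.
  move=> gc Pc v Wv; apply: continuous_comp; first exact: Pc.
  exact/gc/WU.
move=> [dg Dg] Pn; have [dP DP] := Pn.
have dgP v : W v -> differentiable g (Psi v) by move=> Wv; exact/dg/WU.
split=> [v Wv|v]; first by apply: differentiable_comp; [exact: dP|exact: dgP].
have := C_n_sum (index_enum _) xpredT oW (fun i =>
  C_nM oW (C_n_coord i oW (DP v)) (IH _ (Dg (basis i)) (C_n_le Pn))).
apply: C_n_ext => // y Wy.
have dgPy : differentiable (g \o Psi) y.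
  by apply: differentiable_comp; [exact: dP|exact: dgP].
rewrite [RHS]deriveE// (diff_comp (dP y Wy) (dgP y Wy))/= derive_basis.
  by apply: eq_bigr => i _; rewrite -deriveE//; exact: dP.
exact: dgP.
Qed.

Lemma C_n_det (V : normedModType R) n (U : set V) m (M : V -> 'M[R]_m) :
  open U -> (forall i j, C_n n U (fun x => M x i j)) ->
  C_n n U (fun x => \det (M x)).
Proof.
move=> oU Mn; apply: C_n_sum => // s; apply: C_nM => //; first exact: C_n_cst.
exact: C_n_prod.
Qed.

Lemma C_n_invmx (V : normedModType R) n (U : set V) m (M : V -> 'M[R]_m) i j :
  open U -> (forall x, U x -> M x \in unitmx) ->
  (forall i j, C_n n U (fun x => M x i j)) ->
  C_n n U (fun x => invmx (M x) i j).
Proof.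
move=> oU Mu Mn.
have dn : C_n n U (fun x => (\det (M x))^-1).
  apply: C_nV => // [x /Mu|]; first by rewrite unitmxE unitfE.
  exact: C_n_det.
have an : C_n n U (fun x => \adj (M x) i j).
  have : C_n n U (fun x => cofactor (M x) j i).
    apply: C_nM => //; first exact: C_n_cst.
    apply: C_n_det => // k l; apply: C_n_ext (Mn (lift j k) (lift i l)) => // x.
    by rewrite !mxE.
  by apply: C_n_ext => // x _; rewrite mxE.
by apply: C_n_ext (C_nM oU dn an) => // x Ux; rewrite /invmx Mu// [RHS]mxE.
Qed.

End Coordinates.

(** * Smoothness of a Lipschitz inverse *)

Section InverseMap.
Context {R : realType}.

(** The Lipschitz bound carries the first-order expansion of [Phi] over to [Psi], so D Psi = (D
    Phi)^-1 o Psi. This formula bootstraps: if [Psi] is C^n, so is the right-hand side, hence [Psi]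
    is C^(n+1). *)
Lemma smooth_inverse (U W : set (phase R)) (Phi Psi : phase R -> phase R) C :
  open U -> open W -> smooth U Phi ->
  (forall v, W v -> U (Psi v) /\ Phi (Psi v) = v) ->
  (forall v v', W v -> W v' -> `|Psi v - Psi v'| <= C * `|v - v'|) ->
  (forall u h, U u -> 'd Phi u h = 0 -> h = 0) ->
  smooth W Psi.
Proof.
move=> oU oW sPhi PsiK PsiC inj.
have WU v : W v -> U (Psi v) by move=> /PsiK[].
have dPhi u : U u -> differentiable Phi u by move=> Uu; exact: (sPhi 1).1.
(* Row [i] is the image of the [i]-th basis vector, so the differential acts on row vectors by right
   multiplication. *)
pose A u : 'M[R]_4 := \matrix_(i, j) pcoord j ('D_(basis i) Phi u).
pose rv (h : phase R) : 'rV[R]_4 := \row_i pcoord i h.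
have rvA u h : U u -> rv h *m A u = rv ('d Phi u h).
  move=> Uu; apply/rowP => j; rewrite !mxE (derive_basis h (dPhi u Uu)).
  by rewrite linear_sum; apply: eq_bigr => i _; rewrite !mxE linearZ.
have Aunit u : U u -> A u \in unitmx.
  move=> Uu; rewrite -row_free_unit; apply: inj_row_free => r.
  pose h := of_coords (r 0); have -> : r = rv h.
    by apply/rowP => i; rewrite mxE of_coordsK.
  rewrite rvA// => /rowP dh.
  suff -> : h = 0 by apply/rowP => i; rewrite !mxE linear0.
  apply: inj Uu _; apply: pcoord_inj => i; have := dh i.
  by rewrite !mxE linear0.
pose B u w : phase R := of_coords (fun j => \sum_i pcoord i w * invmx (A u) i j).
have rvB u w : rv (B u w) = rv w *m invmx (A u).
  by apply/rowP => j; rewrite !mxE of_coordsK; apply: eq_bigr => i _; rewrite mxE.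
have rv_inj : injective rv.
  by move=> h k /rowP hk; apply: pcoord_inj => i; have := hk i; rewrite !mxE.
have rvD h k : rv (h + k) = rv h + rv k.
  by apply/rowP => j; rewrite !mxE linearD.
have rvZ a h : rv (a *: h) = a *: rv h.
  by apply/rowP => j; rewrite !mxE linearZ.
have Blin u : linear (B u).
  by move=> a h k; apply: rv_inj; rewrite rvD rvZ !rvB rvD rvZ mulmxDl scalemxAl.
pose BL u : {linear phase R -> phase R} :=
  HB.pack (B u) (GRing.isLinear.Build _ _ _ _ (B u) (Blin u)).
have Bc u : continuous (BL u).
  move=> w; apply: (@C_n_coords _ _ 0 setT _ openT) => // j.
  apply: C_n_sum => [|i]; first exact: openT.
  apply: C_nM; [exact: openT| |exact: C_n_cst].
  by apply: C_n_lin; exact: pcoord_continuous.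
have BK u h : U u -> B u ('d Phi u h) = h.
  by move=> Uu; apply: rv_inj; rewrite rvB -rvA// mulmxK// Aunit.
have An n i j : C_n n U (fun u => A u i j).
  have := C_n_coord j oU ((sPhi n.+1).2 (basis i)).
  by apply: C_n_ext => // u _; rewrite mxE.
have dPsi v : W v -> is_diff v Psi (B (Psi v)).
  move=> Wv; apply: (is_diff_of_norm (L := BL (Psi v))) => // eps eps0.
  have Uv := WU _ Wv.
  have [M M0 BM] : exists2 M, 0 < M & forall w, `|B (Psi v) w| <= M * `|w|.
    have /linear_bounded_continuous := Bc (Psi v).
    move=> /linear_boundedP[y [yr By]]; exists (`|y| + 1).
      by rewrite ltr_wpDl.
    by apply: By; rewrite ltr_pwDr// ler_norm.
  (* [C] carries no sign, hence [|C| + 1]. The tolerance below is [eps] divided by the two losses to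
     come: [M] from applying [B], and [|C| + 1] from passing from [k] to [h]. *)
  have C0 : 0 < `|C| + 1 by rewrite ltr_wpDl.
  have e0 : 0 < eps / (M * (`|C| + 1)) by rewrite divr_gt0// mulr_gt0.
  have Pc : \forall h \near 0, W (h + v).
    have : \near v, W v by exact: open_nbhs_nbhs.
    by rewrite (near_shift 0) subr0.
  have kc : (fun h => Psi (h + v) - Psi v) @ (0 : phase R) --> (0 : phase R).
    apply/cvgr0Pnorm_lt => d d0.
    have hd : \forall h \near (0 : phase R), `|h| < (`|C| + 1)^-1 * d.
      by apply: nbhs0_lt; rewrite mulr_gt0// invr_gt0.
    near=> h.
    have Wh : W (h + v) by near: h.
    apply: le_lt_trans (PsiC _ _ Wh Wv) _; rewrite addrK.
    apply: le_lt_trans (_ : (`|C| + 1) * `|h| < _).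
      by rewrite ler_wpM2r// (le_trans (ler_norm _))// lerDl.
    by rewrite -ltr_pdivlMl//; exact: (near hd h).
  have kn : \forall h \near (0 : phase R), let k := Psi (h + v) - Psi v in
      `|Phi (k + Psi v) - Phi (Psi v) - 'd Phi (Psi v) k|
        <= eps / (M * (`|C| + 1)) * `|k|.
    exact: (kc _ (differentiable_norm (dPhi _ Uv) e0)).
  near=> h.
  have Wh : W (h + v) by near: h.
  have /= : let k := Psi (h + v) - Psi v in
      `|Phi (k + Psi v) - Phi (Psi v) - 'd Phi (Psi v) k|
        <= eps / (M * (`|C| + 1)) * `|k| by near: h.
  rewrite subrK (PsiK _ Wh).2 (PsiK _ Wv).2 addrK.
  set k := Psi (h + v) - Psi v => kh.
  (* Since B inverts the differential, k - B h = B ('d Phi k - h), and h is exactly the increment of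
     [Phi] along [k]. *)
  rewrite /= -{1}(BK _ k Uv) -[X in `|X|]opprB normrN.
  rewrite -[B _ _ - _](linearB (BL (Psi v))) /=.
  apply: le_trans (BM _) _.
  rewrite -ler_pdivlMl//; apply: le_trans kh _.
  have kC : `|k| <= (`|C| + 1) * `|h|.
    apply: le_trans (PsiC _ _ Wh Wv) _; rewrite addrK.
    by rewrite ler_wpM2r// (le_trans (ler_norm _))// lerDl.
  apply: le_trans (ler_wpM2l (ltW e0) kC) _.
  rewrite le_eqVlt; apply/orP; left; apply/eqP; field.
  by rewrite !gt_eqF.
elim=> [|n IH].
  move=> v Wv; have [dP _] := dPsi v Wv.
  exact: differentiable_continuous.
split=> [v Wv|w]; first by have [] := dPsi v Wv.
(* The bootstrap: entries of the inverse Jacobian composed with [Psi], which is C^n by induction. *)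
have : C_n n W (fun v => B (Psi v) w).
  apply: C_n_coords => // j; apply: C_n_sum => // i; apply: C_nM => //.
    exact: C_n_cst.
  apply: (C_n_comp (g := fun u => invmx (A u) i j) oU oW WU _ IH).
  exact: C_n_invmx i j oU Aunit (An n).
apply: C_n_ext => // v Wv; have [dP dPE] := dPsi v Wv.
by rewrite deriveE// dPE.
Unshelve. all: by end_near. Qed.

End InverseMap.

(** * Perturbations of the identity *)

Section Perturbation.
Context {R : realType}.

(** Compare [f] with its linearisation along t h and divide by |t|: the linearisation error becomes
    arbitrarily small relative to |h|. *)
Lemma diff_norm_le (V W : normedModType R) (f : V -> W) (u h : V) L :
  differentiable f u ->
  (\forall y \near u, `|f y - f u| <= L * `|y - u|) -> `|'d f u h| <= L * `|h|.
Proof.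
move=> df fL; apply/ler_addgt0Pl => eps eps0.
(* The [+ 1] covers [h = 0]; multiplied by [|h|], this tolerance is still at most [eps]. *)
have e0 : 0 < eps / (`|h| + 1) by rewrite divr_gt0// ltr_wpDl.
have th0 : (fun t : R => t *: h) @ (0 : R)^' --> (0 : V).
  apply: cvg_within_filter.
  by have := @scalel_continuous _ _ h 0; rewrite /continuous_at scale0r.
have fL0 : \forall k \near (0 : V), `|f (k + u) - f u| <= L * `|k|.
  have : \forall k \near (0 : V), `|f (k + u) - f u| <= L * `|k + u - u|.
    by move: fL; rewrite (near_shift 0) subr0.
  by apply: filterS => k; rewrite addrK.
have H1 : \forall t \near (0 : R)^', `|f (t *: h + u) - f u| <= L * `|t *: h|.
  exact: (th0 _ fL0).
have H2 : \forall t \near (0 : R)^',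
    `|f (t *: h + u) - f u - 'd f u (t *: h)| <= eps / (`|h| + 1) * `|t *: h|.
  exact: (th0 _ (differentiable_norm df e0)).
near (0 : R)^' => t.
have t0 : t != 0 by near: t; exact: nbhs_dnbhs_neq.
have h1 : `|f (t *: h + u) - f u| <= L * `|t *: h| by near: t.
have h2 : `|f (t *: h + u) - f u - 'd f u (t *: h)|
  <= eps / (`|h| + 1) * `|t *: h| by near: t.
have : `|'d f u (t *: h)| <= L * `|t *: h| + eps / (`|h| + 1) * `|t *: h|.
  apply: le_trans (lerD h1 h2).
  by have := ler_normB (f (t *: h + u) - f u)
    (f (t *: h + u) - f u - 'd f u (t *: h)); rewrite subKr.
have t1 : 0 < `|t| by rewrite normr_gt0.
rewrite linearZ !normrZ -mulrDl mulrCA ler_pM2l// => /le_trans; apply.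
rewrite mulrDl addrC lerD2r.
rewrite mulrAC ler_pdivrMr ?ltr_wpDl//.
by apply: ler_wpM2l; [exact: ltW|rewrite lerDl].
Unshelve. all: by end_near. Qed.

(* No condition on psi: the strips are invariant under the deck transformation. *)
Definition strip (r : R) : set (phase R) :=
  [set u | [/\ `|u.1.1.1| <= r, `|u.1.1.2| <= r & `|u.2| <= r]].

Definition open_strip (r : R) : set (phase R) :=
  [set u | [/\ `|u.1.1.1| < r, `|u.1.1.2| < r & `|u.2| < r]].

Lemma open_strip_sub r : open_strip r `<=` strip r.
Proof. by move=> u [/ltW xr /ltW yr /ltW wr]. Qed.

Lemma open_open_strip r : open (open_strip r).
Proof.
have oc i : open [set u : phase R | `|pcoord i u| < r].
  have -> : [set u : phase R | `|pcoord i u| < r] =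
      (fun u => `|pcoord i u|) @^-1` [set t | t < r] by [].
  apply: open_comp; last exact: open_lt.
  move=> u _; apply: continuous_comp; first exact: pcoord_continuous.
  exact: norm_continuous.
have := openI (openI (oc (inord 0)) (oc (inord 1))) (oc (inord 3)).
congr open; apply/seteqP; split=> u; rewrite /open_strip /= !pcoordE.
  by move=> [[]].
by move=> [].
Qed.

Lemma strip_norm u r : `|u| <= r -> strip r u.
Proof.
move=> ur; split; rewrite -?pcoord0 -?pcoord1 -?pcoord3;
  exact: le_trans (norm_pcoord _ _) ur.
Qed.

Lemma open_strip_norm u r : `|u| < r -> open_strip r u.
Proof.
move=> ur; split; rewrite -?pcoord0 -?pcoord1 -?pcoord3;
  exact: le_lt_trans (norm_pcoord _ _) ur.
Qed.

(** One constant for both size and Lipschitz quotient, so that the single condition [e * L <= 1 / 2]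
    controls displacement and contraction together. *)
Definition strip_bound (W : normedModType R) (G : phase R -> W) (r L : R) :=
  (forall u, strip r u -> `|G u| <= L) /\
  (forall u v, strip r u -> strip r v -> `|G u - G v| <= L * `|u - v|).

Definition strip_lipschitz (W : normedModType R) (G : phase R -> W) :=
  forall r, exists L, strip_bound G r L.

Definition clamp1 (r t : R) : R := Num.max (- r) (Num.min r t).

(** A retraction onto the strip, 1-Lipschitz because the norm is the maximum of the coordinates;
    precomposing with it preserves the constant of [strip_bound]. *)
Definition clamp (r : R) (u : phase R) : phase R :=
  ((clamp1 r u.1.1.1, clamp1 r u.1.1.2), u.1.2, clamp1 r u.2).

Lemma clamp1_norm r t : 0 <= r -> `|clamp1 r t| <= r.
Proof.
by move=> r0; rewrite /clamp1 ler_norml !maxEle !minEle; do !case: ifP; lra.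
Qed.

Lemma clamp1_lip r s t : `|clamp1 r s - clamp1 r t| <= `|s - t|.
Proof.
rewrite ler_norml /clamp1 !maxEle !minEle.
by case: (leP 0 (s - t)) => st; rewrite ?(ger0_norm st) ?(ltr0_norm st);
  do !case: ifP; lra.
Qed.

Lemma clamp1_id r t : `|t| <= r -> clamp1 r t = t.
Proof.
by rewrite ler_norml /clamp1 maxEle minEle; do !case: ifP; lra.
Qed.

Lemma strip_clamp r u : 0 <= r -> strip r (clamp r u).
Proof. by move=> r0; split; exact: clamp1_norm. Qed.

Lemma clamp_id r u : strip r u -> clamp r u = u.
Proof.
by case: u => -[[x y] p] w [/= xr yr wr]; rewrite /clamp /= !clamp1_id.
Qed.

Lemma clamp_lip r u v : `|clamp r u - clamp r v| <= `|u - v|.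
Proof.
apply: phase_norm_le => i; apply: le_trans (norm_pcoord i _).
move: i; apply: ord4P; rewrite !pcoordE//=; exact: clamp1_lip.
Qed.

End Perturbation.

Lemma is_diff_perturbed {R : realType} (V : normedModType R) (H : V -> V) e u :
  differentiable H u ->
  is_diff u (fun v => v + e *: H v) (fun h => h + e *: 'd H u h).
Proof.
move=> dH; apply: (is_diffD (f := id) (g := e *: H) (df := id)).
exact: (is_diffZ _ (differentiableP dH)).
Qed.

(** * Inversion of id + e H at a fixed small e *)

Section PerturbedIdentity.
Context {R : realType} (H : phase R -> phase R) (r e L : R).
Hypotheses (r0 : 0 <= r) (e0 : 0 <= e).
Hypotheses (HL : strip_bound H r L) (eL : e * L <= 1 / 2).

Let Theta u := u + e *: H (clamp r u).

Let eHlip u v : `|e *: H (clamp r u) - e *: H (clamp r v)| <= 1 / 2 * `|u - v|.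
Proof.
rewrite -scalerBr normrZ ger0_norm//.
have L0 : 0 <= L by apply: le_trans (HL.1 _ (strip_clamp u r0)).
apply: le_trans (_ : e * (L * `|u - v|) <= _).
  apply: ler_wpM2l => //; apply: le_trans (HL.2 _ _ _ _) _; try exact: strip_clamp.
  by apply: ler_wpM2l => //; exact: clamp_lip.
by rewrite mulrA ler_wpM2r.
Qed.

(** The perturbation is 1/2-Lipschitz, so [Theta] shrinks distances by at most the factor 1 - 1/2.
    This yields both injectivity and the Lipschitz constant 2 of the inverse. *)
Lemma Theta_lip u v : `|u - v| <= 2 * `|Theta u - Theta v|.
Proof.
have : `|u - v| <= `|Theta u - Theta v| + 1 / 2 * `|u - v|.
  apply: le_trans (lerD (lexx _) (eHlip u v)).
  have := ler_normB (Theta u - Theta v) (e *: H (clamp r u) - e *: H (clamp r v)).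
  by rewrite /Theta [- (v + _)]opprD [u + _ + _]addrACA addrK.
lra.
Qed.

(** A preimage of [v] is a fixed point of u |-> v - e H (clamp u), a contraction of ratio 1/2. *)
Lemma Theta_surj v : exists u, Theta u = v.
Proof.
pose f u := v - e *: H (clamp r u).
have fT : {homo f : x / [set: phase R] x >-> [set: phase R] x} by [].
have ctr : is_contraction (mkfun fT : {fun setT >-> setT}).
  have h0 : 0 <= 1 / 2 :> R by lra.
  exists (NngNum h0); split => /=; first by lra.
  move=> [u u'] _ /=; rewrite /mkfun /f opprD addrACA subrr add0r -opprD normrN.
  exact: eHlip.
have [|u _ fu] := @banach_fixed_point _ (phase R) setT _ ctr closedT.
  by exists v.
by exists u; rewrite /Theta {1}fu /= /mkfun /f subrK.
Qed.

Definition perturbed_inverse v : phase R := xget v [set u | Theta u = v].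

Lemma perturbed_inverseK v : Theta (perturbed_inverse v) = v.
Proof.
by rewrite /perturbed_inverse; case: xgetP => // /(_ _) nT;
  have [u /nT] := Theta_surj v.
Qed.

Lemma perturbed_inverse_lip v v' :
  `|perturbed_inverse v - perturbed_inverse v'| <= 2 * `|v - v'|.
Proof. by apply: le_trans (Theta_lip _ _) _; rewrite !perturbed_inverseK. Qed.

(** The displacement is e H at a clamped point, hence at most [e * L], uniformly in [v]. This later
    shows that the target domains exhaust X. *)
Lemma perturbed_inverse_near v : `|perturbed_inverse v - v| <= 1 / 2.
Proof.
rewrite -{2}(perturbed_inverseK v) /Theta opprD addNKr normrN normrZ ger0_norm//.
apply: le_trans eL; apply: ler_wpM2l => //; apply: HL.1; exact: strip_clamp.
Qed.

Lemma perturbed_inverse_strip u :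
  strip r u -> perturbed_inverse (u + e *: H u) = u.
Proof.
move=> su; apply/eqP; rewrite -subr_eq0 -normr_le0.
apply: le_trans (Theta_lip _ _) _; rewrite perturbed_inverseK.
by rewrite /Theta clamp_id// subrr normr0 mulr0.
Qed.

Lemma perturbed_inverse_continuous : continuous perturbed_inverse.
Proof.
move=> v; apply/cvgrPdist_lt => d d0.
have vd : \forall w \near v, `|v - w| < d / 2.
  by apply: (@cvgr_dist_lt _ _ _ (nbhs v) _ id) => //; rewrite divr_gt0.
apply: filterS vd => w wd; apply: le_lt_trans (perturbed_inverse_lip _ _) _.
by rewrite mulrC -ltr_pdivlMr.
Qed.

(** The target domain is a preimage under the continuous inverse, which makes it open at once. On
    the strip the clamp is the identity, so [Theta] coincides there with the smooth map id + e H. *)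
Lemma perturbed_diffeo : smooth setT H -> psi_periodic H ->
  diffeo (open_strip r) [set v | open_strip r (perturbed_inverse v)]
    (fun u => u + e *: H u) perturbed_inverse.
Proof.
move=> sH pH.
have oU := @open_open_strip R r.
have oW : open [set v | open_strip r (perturbed_inverse v)].
  by apply: (open_comp _ oU) => v _; exact: perturbed_inverse_continuous.
have Psi_to u : open_strip r u -> perturbed_inverse (u + e *: H u) = u.
  by move=> /open_strip_sub; exact: perturbed_inverse_strip.
have from v : open_strip r (perturbed_inverse v) ->
    perturbed_inverse v + e *: H (perturbed_inverse v) = v.
  move=> /open_strip_sub sv; rewrite -[RHS]perturbed_inverseK /Theta.
  by rewrite (clamp_id sv).
have dH u : differentiable H u by exact: (sH 1%N).1.
have sPhi : smooth (open_strip r) (fun u => u + e *: H u).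
  move=> n; apply: C_nD => //.
    apply: (C_n_lin n _ (L := [the {linear _ -> _} of @idfun (phase R)])).
    by move=> x; exact: cvg_id.
  apply: (C_n_lin_comp (L := [the {linear phase R -> phase R} of *:%R e])) => //.
    exact: scaler_continuous.
  by apply: C_n_sub (sH n).
split=> //.
- by move=> u Uu; rewrite /= Psi_to.
- by move=> v Wv; split => //; exact: from.
- apply: (@smooth_inverse R _ _ _ _ 2 oU oW sPhi).
  + by move=> v Wv; split=> //; exact: from.
  + by move=> v v' _ _; exact: perturbed_inverse_lip.
  (* A kernel vector satisfies h = - e 'd H h, whose norm is at most |h|/2, so h = 0. *)
  move=> u h Uu; have [_ ->] := is_diff_perturbed e (dH u) => /eqP.
  rewrite addr_eq0 => /eqP hE; apply/eqP; rewrite -normr_le0.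
  have dHh : `|'d H u h| <= L * `|h|.
    apply: diff_norm_le => //; apply: filterS (open_nbhs_nbhs (conj oU Uu)).
    by move=> y /open_strip_sub sy; apply: HL.2 => //; exact: open_strip_sub.
  have : `|h| <= 1 / 2 * `|h|.
    rewrite {1}hE normrN normrZ ger0_norm//.
    apply: le_trans (ler_wpM2l e0 dHh) _.
    by rewrite mulrA ler_wpM2r.
  lra.
- move=> u Uu; rewrite pH; case: (H u) => -[[x y] p] w.
  by case: u Uu => -[[a b] c] d _; rewrite /deck /mk_phase /=;
    congr (_, _, _); rewrite addrAC.
Qed.

End PerturbedIdentity.

(** * Domains growing as e tends to 0 *)

Section NearIdentity.
Context {R : realType}.

(** However fast [L] grows, take for r(e) the largest n <= 1/e with e L_n <= 1/2. The cap 1/e makes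
    the maximum finite; a fixed N qualifies as soon as e is small, so r(e) tends to infinity. *)
Lemma slow_radius (L : nat -> R) : exists r : R -> nat,
  (\forall e \near (0 : R)^'+, e * L (r e) <= 1 / 2) /\
  forall N, \forall e \near (0 : R)^'+, (N <= r e)%N.
Proof.
have small l : \forall e \near (0 : R)^'+, e * l <= 1 / 2.
  near=> e; have e0 : 0 < e by near: e; exact: nbhs_right_gt.
  apply: le_trans (_ : e * (`|l| + 1) <= _).
    by rewrite ler_pM2l// (le_trans (ler_norm _))// lerDl.
  rewrite -ler_pdivlMr ?ltr_wpDl//; near: e; apply: nbhs_right_le.
  by rewrite divr_gt0// ltr_wpDl.
pose good e := [pred n : 'I_(Num.truncn e^-1).+1 | e * L n <= 1 / 2].
exists (fun e => \max_(n in good e) n)%N; split=> [|N].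
  near=> e; have e1 : e * L 0%N <= 1 / 2 by near: e; exact: small.
  (* The maximum is attained because 0 is admissible for small e; over an empty set it would be 0
     without the bound. *)
  have [|n] := @eq_bigmax_cond _ (mem (good e)) val.
    by apply/card_gt0P; exists ord0; rewrite inE.
  by rewrite inE => en ->.
near=> e; have e0 : 0 < e by near: e; exact: nbhs_right_gt.
have Ne : (N < (Num.truncn e^-1).+1)%N.
  have ei0 : 0 <= e^-1 by rewrite invr_ge0 ltW.
  rewrite ltnS truncn_ge_nat// -[leRHS]mul1r ler_pdivlMr// mulrC.
  apply: le_trans (_ : 1 / 2 <= 1); last by lra.
  by near: e; exact: small.
have eN : e * L N <= 1 / 2 by near: e; exact: small.
by apply: (leq_bigmax_cond (Ordinal Ne)); rewrite inE.
Unshelve. all: by end_near. Qed.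

Lemma compact_norm_le (K : set (phase R)) :
  compact K -> exists N : nat, forall u, K u -> `|u| <= N%:R.
Proof.
move=> /compact_bounded[M [Mr MK]]; exists (Num.truncn `|M + 1|).+1 => u Ku.
apply: le_trans (MK (M + 1) _ _ Ku) _; first by rewrite ltrDl.
by apply: le_trans (ler_norm _) _; exact/ltW/truncnS_gt.
Qed.

Lemma compact_norm_ball (r : R) :
  exists2 K : set (phase R), compact K & forall u, `|u| <= r -> K u.
Proof.
exists (`[- r, r]%classic `*` `[- r, r]%classic `*` `[- r, r]%classic
  `*` `[- r, r]%classic).
  by do !apply: compact_setX; exact: segment_compact.
move=> u ur; have ui i : -r <= pcoord i u <= r.
  by rewrite -ler_norml; exact: le_trans (norm_pcoord i u) ur.
by split=> /=; [split=> /=; [split|]|]; rewrite in_itv/= -?pcoord0 -?pcoord1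
  -?pcoord2 -?pcoord3 ui.
Qed.

(** The second conjunct records what the remainder estimate will use: the points Psi_e(v), v in K,
    lie in a ball that does not depend on e, and there the clamp has disappeared. *)
Lemma near_identity_exists (H : phase R -> phase R) :
  smooth setT H -> psi_periodic H -> strip_lipschitz H ->
  exists (U W : R -> set (phase R)) (Psi : R -> phase R -> phase R),
    near_identity H U W (fun e u => u + e *: H u) Psi /\
    forall K, compact K -> exists r : R, \forall e \near (0 : R)^'+,
      forall v, K v -> `|Psi e v| <= r /\ Psi e v + e *: H (Psi e v) = v.
Proof.
move=> sH pH lH.
have /choice[L HL] : forall n : nat, exists l, strip_bound H n%:R l.
  by move=> n; exact: lH.
have [r [rL rN]] := slow_radius L.
pose Psi e := perturbed_inverse H (r e)%:R e.
have Psi_near : \forall e \near (0 : R)^'+, forall v, `|Psi e v - v| <= 1 / 2.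
  near=> e => v; have e0 : 0 < e by near: e; exact: nbhs_right_gt.
  apply: (perturbed_inverse_near (ler0n _ _) (ltW e0) (HL (r e))).
  by near: e.
have Psi_norm N : \forall e \near (0 : R)^'+, forall v, `|v| <= N%:R ->
    `|Psi e v| < N.+1%:R.
  near=> e => v vN; rewrite -(subrK v (Psi e v)).
  have Pv : forall v, `|Psi e v - v| <= 1 / 2 by near: e; exact: Psi_near.
  have {}Pv := Pv v.
  apply: le_lt_trans (ler_normD _ _) _; by rewrite -natr1; lra.
have Psi_in N : \forall e \near (0 : R)^'+, forall v, `|v| <= N%:R ->
    open_strip (r e)%:R (Psi e v).
  near=> e => v vN; apply: open_strip_norm.
  have Pv : forall v, `|v| <= N%:R -> `|Psi e v| < N.+1%:R.
    by near: e; exact: Psi_norm.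
  apply: lt_le_trans (Pv v vN) _; rewrite ler_nat; near: e; exact: rN.
exists (fun e => open_strip (r e)%:R),
  (fun e => [set v | open_strip (r e)%:R (Psi e v)]), Psi; split; last first.
  move=> K /compact_norm_le[N KN]; exists N.+1%:R; near=> e => v Kv.
  have e0 : 0 < e by near: e; exact: nbhs_right_gt.
  have PN : forall v, `|v| <= N%:R -> `|Psi e v| < N.+1%:R.
    by near: e; exact: Psi_norm.
  have sP : forall v, `|v| <= N%:R -> open_strip (r e)%:R (Psi e v).
    by near: e; exact: Psi_in.
  have {}PN := ltW (PN v (KN v Kv)).
  have {}sP := open_strip_sub (sP v (KN v Kv)); split=> //.
  rewrite -[RHS](perturbed_inverseK (ler0n _ _) (ltW e0) (HL (r e)))//.
    by rewrite clamp_id.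
  by near: e.
split=> //.
- near=> e; have e0 : 0 < e by near: e; exact: nbhs_right_gt.
  apply: (perturbed_diffeo (ler0n _ _) (ltW e0) (HL (r e))) => //.
  by near: e.
- move=> K /compact_norm_le[N KN]; near=> e => u /KN uN.
  apply: open_strip_norm; apply: le_lt_trans uN _; rewrite ltr_nat.
  by near: e; exact: rN.
- move=> K /compact_norm_le[N KN].
  (* From the ball of radius N, Psi_e leads into the ball of radius N + 1, which lies in the open
     strip once r(e) >= N + 1. *)
  by apply: filterS (Psi_in N) => e PN u /KN; exact: PN.
- move=> K _; exists 0; near=> e => u _.
  by rewrite subrr normr0 mul0r.
Unshelve. all: by end_near. Qed.

End NearIdentity.

(** * Trigonometric polynomials *)

Section RegularFunctions.
Context {R : realType}.

(** These are the requirements of [near_identity_exists], bundled because sums, products and pairs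
    preserve them jointly. *)
Definition regular (W : normedModType R) (h : phase R -> W) :=
  [/\ smooth setT h, strip_lipschitz h & forall u, h (deck u) = h u].

Lemma strip_bound_norm (W : normedModType R) (h : phase R -> W) r L :
  strip_bound h r L -> strip_bound h r `|L|.
Proof.
move=> [hb hl]; split=> [u su|u v su sv].
  exact: le_trans (hb u su) (ler_norm _).
apply: le_trans (hl u v su sv) _; apply: ler_wpM2r => //; exact: ler_norm.
Qed.

Lemma regular_cst (W : normedModType R) (a : W) : regular (fun=> a).
Proof.
split=> // [n|r]; first exact: C_n_cst.
by exists `|a|; split=> // u v _ _; rewrite subrr normr0 mulr_ge0.
Qed.

Lemma regularD (W : normedModType R) (g h : phase R -> W) :
  regular g -> regular h -> regular (fun u => g u + h u).
Proof.
move=> [gs gl gp] [hs hl hp]; split=> [n|r|u]; last by rewrite gp hp.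
  by apply: C_nD (gs n) (hs n); exact: openT.
have [[L [gb gL]] [M [hb hM]]] := (gl r, hl r).
exists (L + M); split=> [u su|u v su sv].
  by apply: le_trans (ler_normD _ _) _; rewrite lerD ?gb ?hb.
rewrite opprD addrACA mulrDl; apply: le_trans (ler_normD _ _) _.
by rewrite lerD ?gL ?hM.
Qed.

Lemma regularM (g h : phase R -> R) :
  regular g -> regular h -> regular (fun u => g u * h u).
Proof.
move=> [gs gl gp] [hs hl hp]; split=> [n|r|u]; last by rewrite gp hp.
  by apply: C_nM (gs n) (hs n); exact: openT.
have [L /strip_bound_norm[gb gL]] := gl r.
have [M /strip_bound_norm[hb hM]] := hl r.
(* Each half pays for one term of g u (h u - h v) + (g u - g v) h v; one half already bounds the
   product itself. *)
exists (`|L| * `|M| + `|L| * `|M|); split=> [u su|u v su sv].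
  rewrite normrM; apply: le_trans (ler_pM _ _ (gb u su) (hb u su)) _ => //.
  by rewrite lerDl mulr_ge0.
have -> : g u * h u - g v * h v = g u * (h u - h v) + (g u - g v) * h v by ring.
apply: le_trans (ler_normD _ _) _; rewrite !normrM mulrDl lerD//.
  by rewrite -mulrA ler_pM ?gb ?hM.
by rewrite mulrAC ler_pM ?gL ?hb.
Qed.

Lemma regular_pair (W W' : normedModType R) (g : phase R -> W)
    (h : phase R -> W') :
  regular g -> regular h -> regular (fun u => (g u, h u)).
Proof.
move=> [gs gl gp] [hs hl hp]; split=> [n|r|u]; last by rewrite gp hp.
  by apply: C_n_pair (gs n) (hs n); exact: openT.
have [L /strip_bound_norm[gb gL]] := gl r.
have [M /strip_bound_norm[hb hM]] := hl r.
exists (`|L| + `|M|); split=> [u su|u v su sv]; rewrite prod_normE ge_max /=.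
  rewrite (le_trans (gb u su)) ?lerDl// (le_trans (hb u su))// lerDr.
  by [].
rewrite (le_trans (gL _ _ su sv)) ?(le_trans (hM _ _ su sv))//.
  by rewrite ler_wpM2r// lerDr.
by rewrite ler_wpM2r// lerDl.
Qed.

(** The angle is excluded: it is neither periodic nor bounded on strips, and enters only through
    [regular_trigo]. *)
Lemma regular_coord i : i != inord 2 -> regular (pcoord i).
Proof.
move=> i2; split=> [n|r|u].
- by apply: C_n_lin; exact: pcoord_continuous.
- exists (`|r| + 1); split=> [u|u v _ _].
    move=> su; apply: (@le_trans _ _ r).
      by move: i i2; apply: ord4P; rewrite pcoordE ?eqxx//; case: su.
    by apply: le_trans (ler_norm r) _; rewrite lerDl.
  rewrite -linearB /=; apply: le_trans (norm_pcoord _ _) _.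
  by rewrite ler_peMl// lerDr.
- by move: i i2; apply: ord4P; rewrite !pcoordE ?eqxx.
Qed.

Lemma derive_le1_lipschitz (g dg : R -> R) :
  (forall t : R, is_derive t 1 g (dg t)) -> (forall t, `|dg t| <= 1) ->
  forall s t, `|g s - g t| <= `|s - t|.
Proof.
move=> gdg dg1; suff H s t : s <= t -> `|g t - g s| <= `|t - s|.
  move=> s t; have [st|/ltW ts] := leP s t; last exact: H.
  by rewrite distrC [leRHS]distrC; exact: H.
move=> st; have gc : continuous g.
  move=> x; apply/differentiable_continuous/derivable1_diffP.
  by have [] := gdg x.
have [c _ ->] := MVT_segment st (fun x _ => gdg x) (continuous_subspaceT gc).
by rewrite normrM ler_piMl.
Qed.

Lemma lipschitz_trigo (s t : R) :
  `|cos s - cos t| <= `|s - t| /\ `|sin s - sin t| <= `|s - t|.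
Proof.
split.
  apply: derive_le1_lipschitz (@is_derive_cos R) _ _ _ => u.
  by rewrite normrN ler_norml sin_geN1 sin_le1.
apply: derive_le1_lipschitz (@is_derive_sin R) _ _ _ => u.
by rewrite ler_norml cos_geN1 cos_le1.
Qed.

Lemma periodicz (g : R -> R) T (k : int) t :
  periodic g T -> g (t + k%:~R * T) = g t.
Proof.
move=> gT; case: k => n; first by rewrite mulr_natl periodicn.
by rewrite -[LHS](periodicn gT n.+1) NegzE mulrNz mulNr mulr_natl subrK.
Qed.

Lemma regular_trigo (k : int) :
  regular (fun u : phase R => cos (k%:~R * psi_of u)) /\
  regular (fun u : phase R => sin (k%:~R * psi_of u)).
Proof.
have kn n : C_n n setT (fun u : phase R => k%:~R * psi_of u).
  apply: C_nM; [exact: openT|exact: C_n_cst|].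
  have := @C_n_lin _ _ _ n setT (pcoord (inord 2)) (@pcoord_continuous R _).
  by apply: C_n_ext; [exact: openT|move=> u _; rewrite /= pcoordE].
have kL (g : R -> R) : (forall s t, `|g s - g t| <= `|s - t|) ->
    (forall s, `|g s| <= 1) -> strip_lipschitz (fun u => g (k%:~R * psi_of u)).
  move=> gL gb r; exists (1 + `|k%:~R|); split=> [u _|u v _ _].
    by apply: le_trans (gb _) _; rewrite lerDl.
  apply: le_trans (gL _ _) _; rewrite -mulrBr normrM.
  apply: ler_pM => //; first by rewrite lerDr.
  rewrite (_ : psi_of u - psi_of v = pcoord (inord 2) (u - v)) ?norm_pcoord//.
  by rewrite linearB/= !pcoordE.
have kp u : k%:~R * psi_of (deck u) = k%:~R * psi_of u + k%:~R * (pi *+ 2) :> R.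
  by rewrite -mulrDr -[pi *+ 2]mulr_natl.
split; split=> [n||u].
- by have [] := C_n_trigo openT (kn n).
- by apply: kL => [s t|s]; [have [] := lipschitz_trigo s t|exact: cos_max].
- by rewrite kp periodicz//; exact: cosD2pi.
- by have [] := C_n_trigo openT (kn n).
- by apply: kL => [s t|s]; [have [] := lipschitz_trigo s t|exact: sin_max].
- by rewrite kp periodicz//; exact: sinD2pi.
Qed.

Definition cregular (g : phase R -> R[i]) :=
  regular (fun u => complex.Re (g u)) /\ regular (fun u => complex.Im (g u)).

Lemma eq_cregular (g h : phase R -> R[i]) : g =1 h -> cregular g -> cregular h.
Proof. by move=> /funext ->. Qed.

Lemma cregular_cst a : cregular (fun=> a).
Proof. by split; exact: regular_cst. Qed.

Lemma cregularD g h : cregular g -> cregular h -> cregular (fun u => g u + h u).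
Proof.
move=> [g1 g2] [h1 h2]; split.
  rewrite (_ : (fun u => _) = fun u => complex.Re (g u) + complex.Re (h u)).
    exact: regularD.
  by apply/funext => u; case: (g u) => ? ?; case: (h u).
rewrite (_ : (fun u => _) = fun u => complex.Im (g u) + complex.Im (h u)).
  exact: regularD.
by apply/funext => u; case: (g u) => ? ?; case: (h u).
Qed.

Lemma cregularM g h : cregular g -> cregular h -> cregular (fun u => g u * h u).
Proof.
move=> [g1 g2] [h1 h2]; split.
  rewrite (_ : (fun u => _) = fun u => complex.Re (g u) * complex.Re (h u)
      + (-1) * (complex.Im (g u) * complex.Im (h u))).
    by apply: regularD; [|apply: regularM; first exact: regular_cst];
      exact: regularM.
  by apply/funext => u; rewrite mulN1r; case: (g u) => ? ?; case: (h u).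
rewrite (_ : (fun u => _) = fun u => complex.Re (g u) * complex.Im (h u)
    + complex.Im (g u) * complex.Re (h u)).
  by apply: regularD; exact: regularM.
by apply/funext => u; case: (g u) => ? ?; case: (h u).
Qed.

Lemma cregularX g n : cregular g -> cregular (fun u => g u ^+ n).
Proof.
move=> gr; elim: n => [|n IH]; first exact: cregular_cst.
by apply: eq_cregular (cregularM gr IH) => u; rewrite exprS.
Qed.

Lemma cregular_sum (I : Type) (s : seq I) (G : I -> phase R -> R[i]) :
  (forall i, cregular (G i)) -> cregular (fun u => \sum_(i <- s) G i u).
Proof.
move=> Gr; elim: s => [|i s IH].
  by apply: eq_cregular (cregular_cst 0) => u; rewrite big_nil.
by apply: eq_cregular (cregularD (Gr i) IH) => u; rewrite big_cons.
Qed.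

Lemma regular_monomial alpha : cregular (@monomial R alpha).
Proof.
move: alpha => [[[a b] k] c].
have r0 : regular (fun u : phase R => u.1.1.1).
  have := @regular_coord (inord 0); rewrite -val_eqE /= !inordK// => /(_ isT).
  by congr regular; apply/funext => u; rewrite pcoordE.
have r1 : regular (fun u : phase R => u.1.1.2).
  have := @regular_coord (inord 1); rewrite -val_eqE /= !inordK// => /(_ isT).
  by congr regular; apply/funext => u; rewrite pcoordE.
have r3 : regular (fun u : phase R => u.2).
  have := @regular_coord (inord 3); rewrite -val_eqE /= !inordK// => /(_ isT).
  by congr regular; apply/funext => u; rewrite pcoordE.
have [rc rs] := regular_trigo k.
apply: cregularM; last by apply: cregularX; split; [|exact: regular_cst].
apply: cregularM; last by split.
apply: cregularM; apply: cregularX; split=> //=.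
rewrite (_ : (fun u => _) = fun u : phase R => (-1) * u.1.1.2).
  by apply: regularM => //; exact: regular_cst.
by apply/funext => u; rewrite mulN1r.
Qed.

(** Taking real parts makes this a vector field for any complex [G]; that nothing is lost in the psi
    and w components is a separate matter, settled for the averaged field by [averaged_real]. *)
Definition field_of (G : component -> phase R -> R[i]) (u : phase R) : phase R :=
  mk_phase (G Cz u) (complex.Re (G Cpsi u)) (complex.Re (G Cw u)).

Lemma regular_field_of G : (forall j, cregular (G j)) -> regular (field_of G).
Proof.
move=> Gr; apply: regular_pair (Gr Cw).1; apply: regular_pair (Gr Cpsi).1.
exact: regular_pair (Gr Cz).1 (Gr Cz).2.
Qed.

End RegularFunctions.

(** * The homological equation *)

Section Homological.
Context {R : realType} (omega0 Omega0 : R).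

(* The derivative at u in the direction v; split into real and imaginary parts
   because R[i] is not a normed module over R. *)
Definition cderive (u v : phase R) (g : phase R -> R[i]) (d : R[i]) :=
  is_derive u v (fun w => complex.Re (g w)) (complex.Re d) /\
  is_derive u v (fun w => complex.Im (g w)) (complex.Im d).

Lemma eq_cderive u v g h d d' : g =1 h -> d = d' ->
  cderive u v g d -> cderive u v h d'.
Proof. by move=> /funext -> ->. Qed.

Lemma cderive_cst u v a : cderive u v (fun=> a) 0.
Proof. by split; exact: is_derive_cst. Qed.

Lemma cderiveD u v g h dg dh : cderive u v g dg -> cderive u v h dh ->
  cderive u v (fun w => g w + h w) (dg + dh).
Proof.
move=> [g1 g2] [h1 h2]; split.
  rewrite (_ : (fun w => _) = (fun w => complex.Re (g w)) \+
    (fun w => complex.Re (h w))); last first.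
    by apply/funext => w /=; case: (g w) => ? ?; case: (h w).
  by apply: is_derive_eq; case: dg {g1 g2} => ? ?; case: dh {h1 h2}.
rewrite (_ : (fun w => _) = (fun w => complex.Im (g w)) \+
  (fun w => complex.Im (h w))); last first.
  by apply/funext => w /=; case: (g w) => ? ?; case: (h w).
by apply: is_derive_eq; case: dg {g1 g2} => ? ?; case: dh {h1 h2}.
Qed.

Lemma cderiveM u v g h dg dh : cderive u v g dg -> cderive u v h dh ->
  cderive u v (fun w => g w * h w) (dg * h u + g u * dh).
Proof.
move=> [g1 g2] [h1 h2]; split.
  rewrite (_ : (fun w => _) =
      (fun w => complex.Re (g w)) * (fun w => complex.Re (h w)) -
      (fun w => complex.Im (g w)) * (fun w => complex.Im (h w))); last first.
    by apply/funext => w; rewrite !fctE; case: (g w) => ? ?; case: (h w).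
  apply: (is_derive_eq (is_deriveB (is_deriveM g1 h1) (is_deriveM g2 h2))).
  rewrite /GRing.scale /=.
  move: dg dh (g u) (h u) {g1 g2 h1 h2} => [? ?] [? ?] [? ?] [? ?] /=; ring.
rewrite (_ : (fun w => _) =
    (fun w => complex.Re (g w)) * (fun w => complex.Im (h w)) +
    (fun w => complex.Im (g w)) * (fun w => complex.Re (h w))); last first.
  by apply/funext => w; rewrite !fctE; case: (g w) => ? ?; case: (h w).
apply: (is_derive_eq (is_deriveD (is_deriveM g1 h2) (is_deriveM g2 h1))).
rewrite /GRing.scale /=.
move: dg dh (g u) (h u) {g1 g2 h1 h2} => [? ?] [? ?] [? ?] [? ?] /=; ring.
Qed.

Local Notation L := (L0 omega0 Omega0).

(* i mu is the eigenvalue; mu itself is kept real. *)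
Definition eigenfunction (mu : R) (g : phase R -> R[i]) :=
  forall u, cderive u (L u) g ((0 +i* mu) * g u).

(** Differentiation along L0 is a derivation, so eigenvalues add; a monomial collects those of z,
    its conjugate, exp(i k psi) and w. *)
Lemma eigenfunctionM mu nu g h : eigenfunction mu g -> eigenfunction nu h ->
  eigenfunction (mu + nu) (fun u => g u * h u).
Proof.
move=> gm hn u; apply: eq_cderive (cderiveM (gm u) (hn u)) => //.
have -> : (0 +i* (mu + nu)) = (0 +i* mu) + (0 +i* nu) :> R[i].
  by apply/eqP; rewrite eq_complex /= addr0 !eqxx.
by ring.
Qed.

Lemma eigenfunction1 : eigenfunction 0 (fun=> 1).
Proof.
move=> u; apply: eq_cderive (cderive_cst _ _ _) => //.
by rewrite mulr1; apply/eqP; rewrite eq_complex /= !eqxx.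
Qed.

Lemma eigenfunctionX mu g n : eigenfunction mu g ->
  eigenfunction (n%:R * mu) (fun u => g u ^+ n).
Proof.
move=> gm; elim: n => [|n IH].
  by rewrite mul0r => u; apply: eq_cderive (eigenfunction1 u).
have := eigenfunctionM gm IH; rewrite (_ : mu + _ = n.+1%:R * mu); last first.
  by rewrite -natr1; ring.
by move=> gn u; apply: eq_cderive (gn u) => [w|]; rewrite exprS.
Qed.

Lemma is_derive_pcoord i u v : is_derive u v (@pcoord R i) (pcoord i v).
Proof.
have Lc := @pcoord_continuous R i.
split; last exact: derive_lin.
by apply: diff_derivable; exact: linear_differentiable.
Qed.

Lemma eigenfunction_z : eigenfunction omega0 (@z_of R).
Proof.
move=> u; split.
  have := is_derive_pcoord (inord 0) u (L u); rewrite pcoordE.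
  by congr is_derive; apply/funext => w; rewrite pcoordE.
have := is_derive_pcoord (inord 1) u (L u); rewrite pcoordE.
by congr is_derive; apply/funext => w; rewrite pcoordE.
Qed.

Lemma eigenfunction_conjz : eigenfunction (- omega0) (fun u => conjc (z_of u)).
Proof.
move=> u; have [dRe dIm] := eigenfunction_z u; split=> /=.
  by apply: is_derive_eq dRe _; rewrite /=; ring.
by apply: (is_derive_eq (is_deriveN dIm)); rewrite /=; ring.
Qed.

Lemma eigenfunction_w : eigenfunction 0 (fun u => (w_of u)%:C).
Proof.
move=> u; have /= dw := is_derive_pcoord (inord 3) u (L u); split=> /=; last first.
  by apply: is_derive_eq (is_derive_cst _ _ _) _; rewrite !mul0r addr0.
rewrite (_ : (fun w => _) = pcoord (inord 3)); last first.
  by apply/funext => w; rewrite pcoordE.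
by apply: is_derive_eq dw _; rewrite pcoordE /=; ring.
Qed.

Lemma eigenfunction_expi (k : int) :
  eigenfunction (k%:~R * Omega0) (fun u => expi (k%:~R * psi_of u)).
Proof.
move=> u.
have dpsi : is_derive u (L u) (fun u => k%:~R * psi_of u) (k%:~R * Omega0).
  have dp := is_derive_pcoord (inord 2) u (L u).
  rewrite (_ : (fun u => _) = k%:~R *: pcoord (inord 2)); last first.
    by apply/funext => w; rewrite !fctE pcoordE.
  by apply: is_derive_eq; rewrite pcoordE.
have df : differentiable (fun u : phase R => k%:~R * psi_of u) u.
  rewrite (_ : (fun u => _) = k%:~R *: pcoord (inord 2)); last first.
    by apply/funext => w; rewrite !fctE pcoordE.
  apply: differentiableZ; apply: linear_differentiable; exact: pcoord_continuous.
have [_ dE] := dpsi; split => /=.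
  apply: (is_derive_eq (is_derive_comp1 (L u) df (is_derive_cos _))).
  by rewrite dE /=; ring.
apply: (is_derive_eq (is_derive_comp1 (L u) df (is_derive_sin _))).
by rewrite dE /=; ring.
Qed.

Lemma eigenfunction_monomial alpha :
  eigenfunction (homological_eigenvalue omega0 Omega0 Cpsi alpha)
    (monomial alpha).
Proof.
move: alpha => [[[a b] k] c] u.
have := eigenfunctionM (eigenfunctionM (eigenfunctionM
  (eigenfunctionX a eigenfunction_z) (eigenfunctionX b eigenfunction_conjz))
  (eigenfunction_expi k)) (eigenfunctionX c eigenfunction_w).
rewrite (_ : _ + c%:R * 0 =
  homological_eigenvalue omega0 Omega0 Cpsi (a, b, k, c)); last first.
  by rewrite /=; ring.
exact.
Qed.

Definition trig_poly (s : seq multi_index) (c : multi_index -> R[i])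
    (u : phase R) : R[i] := \sum_(alpha <- s) c alpha * monomial alpha u.

Lemma cregular_trig_poly s c : cregular (trig_poly s c).
Proof.
apply: cregular_sum => alpha; apply: cregularM; first exact: cregular_cst.
exact: regular_monomial.
Qed.

Lemma cderive_trig_poly s c u :
  cderive u (L u) (trig_poly s c) (trig_poly s (fun alpha =>
    (0 +i* homological_eigenvalue omega0 Omega0 Cpsi alpha) * c alpha) u).
Proof.
rewrite /trig_poly; elim: s => [|alpha s IH].
  apply: eq_cderive (cderive_cst _ _ 0) => [w|]; by rewrite big_nil.
have := cderiveD (cderiveM (cderive_cst u (L u) (c alpha))
  (eigenfunction_monomial alpha u)) IH.
apply: eq_cderive => [w|]; first by rewrite big_cons.
by rewrite big_cons; ring.
Qed.

Lemma trig_polyD s c d u :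
  trig_poly s c u + trig_poly s d u = trig_poly s (c \+ d) u.
Proof.
by rewrite /trig_poly -big_split; apply: eq_bigr => alpha _; rewrite mulrDl.
Qed.

Lemma trig_polyZ s a c u :
  a * trig_poly s c u = trig_poly s (fun alpha => a * c alpha) u.
Proof.
by rewrite /trig_poly mulr_sumr; apply: eq_bigr => alpha _; rewrite mulrA.
Qed.

End Homological.

(** * The averaged field and the solution of the homological equation *)

Section Averaging.
Context {R : realType} (omega0 Omega0 : R) (f : component -> multi_index -> R[i]).
Hypothesis f_finite : forall j, finite_set [set alpha | f j alpha != 0].

Let lambda := homological_eigenvalue omega0 Omega0.
(** One list, the support of [f j], indexes F, H and the averaged field alike, so equations among
    them can be checked coefficient by coefficient. *)
Let s j : seq multi_index :=
  finmap.enum_fset (fset_set [set alpha | f j alpha != 0]).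

Definition averaged_coef j alpha := if lambda j alpha == 0 then f j alpha else 0.

(** At a resonance the coefficient of H is free, as it is multiplied by 0; it is set to 0. *)
Definition homological_coef j alpha :=
  if lambda j alpha == 0 then 0 else - f j alpha / (0 +i* lambda j alpha).

Lemma homological_coefP j alpha :
  f j alpha + (0 +i* lambda j alpha) * homological_coef j alpha =
  averaged_coef j alpha.
Proof.
rewrite /homological_coef /averaged_coef.
have [l0|l0] := eqVneq; first by rewrite mulr0 addr0.
have l1 : (0 +i* lambda j alpha) != 0 :> R[i] by rewrite eq_complex /= eqxx.
by rewrite mulrCA mulfV// mulr1 subrr.
Qed.

(** Terms off the support of [f j] vanish, so even an infinite [D j] gives a sum over one finite
    list. It serves [setT] for F and the resonant set for the averaged field. *)
Lemma trig_poly_fsbig (D : component -> set multi_index) j u :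
  \sum_(alpha \in D j) (f j alpha * monomial alpha u) =
  trig_poly (s j) (fun alpha => if alpha \in D j then f j alpha else 0) u.
Proof.
rewrite fsbig_mkcond (fsbigTE (fset_set [set alpha | f j alpha != 0])).
  rewrite /trig_poly; apply: eq_bigr => alpha _; rewrite /patch.
  by case: ifP => // _; rewrite mul0r.
move=> alpha; rewrite in_fset_set// notin_setE /= => /negP; rewrite negbK.
by move=> /eqP f0; rewrite /patch f0 mul0r; case: ifP.
Qed.

Lemma field_ofE (G : component -> phase R -> R[i]) u v :
  (forall j, component_of j v = G j u) -> field_of G u = v.
Proof.
move=> vG; rewrite /field_of -!vG; case: v {vG} => -[[x y] p] w.
by rewrite /mk_phase.
Qed.

Lemma component_field_of (G : component -> phase R -> R[i]) u :
  complex.Im (G Cpsi u) = 0 -> complex.Im (G Cw u) = 0 ->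
  forall j, component_of j (field_of G u) = G j u.
Proof.
rewrite /field_of /mk_phase => p0 w0 [] /=; rewrite /z_of /psi_of /w_of /=.
- by case: (G Cz u).
- by case: (G Cpsi u) p0 => ? ? /= ->.
- by case: (G Cw u) w0 => ? ? /= ->.
Qed.

(** The involution on indices that corresponds to complex conjugation of monomials. *)
Let tau (alpha : multi_index) : multi_index :=
  let: (a, b, k, c) := alpha in (b, a, - k, c).

Let tauK : involutive tau.
Proof. by move=> [[[a b] k] c] /=; rewrite opprK. Qed.

Lemma monomial_tau alpha u : monomial (tau alpha) u = conjc (@monomial R alpha u).
Proof.
case: alpha => [[[a b] k] c] /=; rewrite !rmorphM !rmorphXn /=.
congr (_ * _ * _); last by rewrite oppr0.
  by rewrite opprK mulrC.
by rewrite /expi /= mulrNz mulNr cosN sinN.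
Qed.

(** For psi and w, [tau] negates the eigenvalue, so it permutes the resonant indices of the support
    while conjugating coefficients and monomials. The sum thus equals its own conjugate. For z the
    shift -1 in the eigenvalue breaks this symmetry. *)
Lemma averaged_real j u : j <> Cz -> real_coefficients (f j) ->
  complex.Im (trig_poly (s j) (averaged_coef j) u) = 0.
Proof.
move=> jz fr; pose S := trig_poly (s j) (averaged_coef j) u.
have ftau alpha : f j (tau alpha) = conjc (f j alpha).
  by case: alpha => [[[a b] k] c]; exact: fr.
have ltau alpha : (lambda j (tau alpha) == 0) = (lambda j alpha == 0).
  suff -> : lambda j (tau alpha) = - lambda j alpha by rewrite oppr_eq0.
  case: alpha => [[[a b] k] c]; rewrite /lambda.
  by case: j jz {fr ftau S} => //= _; rewrite mulrNz; ring.
have stau : perm_eq (map tau (s j)) (s j).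
  apply: uniq_perm.
  - by rewrite map_inj_uniq; [exact: finmap.fset_uniq|exact: can_inj tauK].
  - exact: finmap.fset_uniq.
  move=> alpha; rewrite -{1}(tauK alpha) mem_map; last exact: can_inj tauK.
  rewrite !in_fset_set//; apply/idP/idP; rewrite !inE /= ?ftau ?conjc_eq0//.
have Sconj : conjc S = S.
  rewrite /S /trig_poly -[RHS](perm_big _ stau) big_map rmorph_sum /=.
  apply: eq_bigr => alpha _; rewrite rmorphM /= -monomial_tau; congr (_ * _).
  by rewrite /averaged_coef ltau ftau; case: ifP => // _; rewrite conjc0.
rewrite -/S; move: Sconj; case: S => x y [] /eqP.
by rewrite eq_sym -addr_eq0 -mulr2n mulrn_eq0 /= => /eqP.
Qed.

Definition averaged_field := field_of (fun j => trig_poly (s j) (averaged_coef j)).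

Definition homological_field :=
  field_of (fun j => trig_poly (s j) (homological_coef j)).

(* The linear part of the affine map L0. *)
Definition L0lin (h : phase R) : phase R := mk_phase ((0 +i* omega0) * z_of h) 0 0.

Lemma L0D e u h :
  L0 omega0 Omega0 (u + e *: h) = L0 omega0 Omega0 u + e *: L0lin h.
Proof.
case: u => -[[x y] p] w; case: h => -[[a b] c] d.
apply: pcoord_inj => i; rewrite linearD linearZ /=; move: i; apply: ord4P;
  rewrite !pcoordE /= /GRing.scale /=; ring.
Qed.

Lemma regular_trig_field (c : component -> multi_index -> R[i]) :
  regular (field_of (fun j => trig_poly (s j) (c j))).
Proof. by apply: regular_field_of => j; exact: cregular_trig_poly. Qed.

Lemma pcoord_derive (G : phase R -> phase R) i u v : differentiable G u ->
  pcoord i ('d G u v) = 'D_v (fun w => pcoord i (G w)) u.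
Proof.
move=> dG; have Lc := @pcoord_continuous R i.
have dL w : differentiable (@pcoord R i) w by exact: linear_differentiable.
rewrite deriveE; last exact: (differentiable_comp (g := @pcoord R i)).
by rewrite (diff_comp (g := @pcoord R i) dG (dL _)) /= diff_lin.
Qed.

(** Differentiation along L0 multiplies each coefficient by i lambda^(psi) in every component. In
    the z component, subtracting i omega0 H_z lowers this to i lambda^(z); in psi and w, [L0lin]
    vanishes and lambda^(psi) is already right. What remains is [homological_coefP]. *)
Lemma homological_equation F u : has_expansion (fun=> setT) f F ->
  F u + 'd homological_field u (L0 omega0 Omega0 u) - L0lin (homological_field u)
  = averaged_field u.
Proof.
move=> FE; set H := homological_field; set v := L0 omega0 Omega0 u.
have dH : differentiable H u.
  by have [sH _ _] := regular_trig_field homological_coef; exact: (sH 1%N).1.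
have FE' : F u = field_of (fun j => trig_poly (s j) (f j)) u.
  apply/esym/field_ofE => j; rewrite FE (trig_poly_fsbig (fun=> setT)).
  by apply: eq_bigr => alpha _; rewrite ifT// in_setT.
pose mu := homological_eigenvalue omega0 Omega0 Cpsi.
pose dh j :=
  trig_poly (s j) (fun alpha => (0 +i* mu alpha) * homological_coef j alpha) u.
have dhE j : cderive u v (trig_poly (s j) (homological_coef j)) (dh j).
  exact: cderive_trig_poly.
have eqz : trig_poly (s Cz) (f Cz) u + dh Cz
    - (0 +i* omega0) * trig_poly (s Cz) (homological_coef Cz) u =
    trig_poly (s Cz) (averaged_coef Cz) u.
  rewrite /dh -mulNr trig_polyZ !trig_polyD /trig_poly.
  apply: eq_bigr => alpha _; congr (_ * _); rewrite /= -homological_coefP.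
  rewrite -addrA -mulrDl; congr (_ + _ * _); apply/eqP.
  rewrite eq_complex /=; apply/andP; split; first by apply/eqP; ring.
  case: alpha => [[[a b] k] c]; rewrite /mu /lambda /=.
  by apply/eqP; ring.
have eqj j : j <> Cz -> trig_poly (s j) (f j) u + dh j =
    trig_poly (s j) (averaged_coef j) u.
  move=> jz; rewrite /dh trig_polyD /trig_poly.
  apply: eq_bigr => alpha _; congr (_ * _); rewrite /= -homological_coefP.
  by congr (_ + (0 +i* _) * _); case: alpha => [[[a b] k] c]; case: j jz.
have dH0 : pcoord (inord 0) ('d H u v) = complex.Re (dh Cz).
  rewrite pcoord_derive//; have [[_ <-] _] := dhE Cz.
  by congr ('D_v _ u); apply/funext => w; rewrite pcoord0.
have dH1 : pcoord (inord 1) ('d H u v) = complex.Im (dh Cz).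
  rewrite pcoord_derive//; have [_ [_ <-]] := dhE Cz.
  by congr ('D_v _ u); apply/funext => w; rewrite pcoord1.
have dH2 : pcoord (inord 2) ('d H u v) = complex.Re (dh Cpsi).
  rewrite pcoord_derive//; have [[_ <-] _] := dhE Cpsi.
  by congr ('D_v _ u); apply/funext => w; rewrite pcoord2.
have dH3 : pcoord (inord 3) ('d H u v) = complex.Re (dh Cw).
  rewrite pcoord_derive//; have [[_ <-] _] := dhE Cw.
  by congr ('D_v _ u); apply/funext => w; rewrite pcoord3.
apply: pcoord_inj => i; rewrite linearB linearD /=; move: i.
rewrite FE' /averaged_field /H /homological_field /L0lin /field_of.
have zE : z_of (mk_phase (trig_poly (s Cz) (homological_coef Cz) u)
   (complex.Re (trig_poly (s Cpsi) (homological_coef Cpsi) u))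
   (complex.Re (trig_poly (s Cw) (homological_coef Cw) u))) =
   trig_poly (s Cz) (homological_coef Cz) u.
  by rewrite /z_of /=; case: (trig_poly _ _ _).
rewrite zE.
apply: ord4P; rewrite ?dH0 ?dH1 ?dH2 ?dH3 !pcoordE /mk_phase [LHS]/= [RHS]/=.
- by rewrite -eqz raddfB raddfD.
- by rewrite -eqz raddfB raddfD.
- by rewrite -eqj// raddfD subr0.
- by rewrite -eqj// raddfD subr0.
Qed.

Lemma averaged_expansion :
  real_coefficients (f Cpsi) -> real_coefficients (f Cw) ->
  has_expansion (resonant omega0 Omega0) f averaged_field.
Proof.
move=> fp fw j u; rewrite trig_poly_fsbig component_field_of ?averaged_real//.
apply: eq_bigr => alpha _; congr (_ * _); rewrite /averaged_coef.
congr (if _ then _ else _); apply/eqP/idP; by rewrite inE.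
Qed.

End Averaging.

(** D Phi sends X to X + e 'd H X, and L0 v = L0 u + e L0lin (H u) exactly. By the homological
    equation the terms of order e add up to Fbar at u; moving it to v costs e (Fbar u - Fbar v). *)
Lemma pushforward_perturbed {R : realType} (omega0 Omega0 e : R)
    (H Psi F Fbar : phase R -> phase R)
    (Rem : phase R -> phase R) (v u : phase R) : Psi v = u ->
  differentiable H u -> u + e *: H u = v ->
  F u + 'd H u (L0 omega0 Omega0 u) - L0lin omega0 (H u) = Fbar u ->
  pushforward_field (fun u => u + e *: H u) Psi
      (fun u => L0 omega0 Omega0 u + e *: F u + Rem u) v
    - (L0 omega0 Omega0 v + e *: Fbar v) =
  Rem u + e *: (Fbar u - Fbar v) + (e ^+ 2) *: 'd H u (F u)
    + e *: 'd H u (Rem u).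
Proof.
move=> Pv dH uv hom.
pose X := L0 omega0 Omega0 u + e *: F u + Rem u.
have -> : pushforward_field (fun w => w + e *: H w) Psi
    (fun w => L0 omega0 Omega0 w + e *: F w + Rem w) v = X + e *: 'd H u X.
  rewrite /pushforward_field Pv.
  have [_ dE] := is_diff_perturbed e dH.
  exact: (congr1 (fun g => g X) dE).
have -> : L0 omega0 Omega0 v = L0 omega0 Omega0 u + e *: L0lin omega0 (H u).
  by rewrite -uv L0D.
have -> : 'd H u X =
    'd H u (L0 omega0 Omega0 u) + e *: 'd H u (F u) + 'd H u (Rem u).
  by rewrite /X !linearD linearZ.
rewrite -hom /X.
set a := L0 _ _ u; set b := 'd H u a; set c := 'd H u (F u).
set d := 'd H u (Rem u).
set l := L0lin _ _.
apply: pcoord_inj => i.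
clearbody a b c d l; clear.
by rewrite !(linearD, linearB, linearZ) /= /GRing.scale /=; ring.
Qed.

Unset Implicit Arguments.
Set Strict Implicit.

Theorem theorem4p3 (R : realType) (omega0 Omega0 : R) (omega0_gt0 : 0 < omega0)
    (F : phase R -> phase R) (f : component -> multi_index -> R[i])
    (f_finite : forall j, finite_set [set alpha | f j alpha != 0])
    (f_psi_real : real_coefficients (f Cpsi))
    (f_w_real : real_coefficients (f Cw))
    (F_expansion : has_expansion (fun=> setT) f F)
    (Rem : R -> phase R -> phase R)
    (Rem_periodic : forall e, psi_periodic (Rem e))
    (Rem_O : O_eps2 Rem) :
  exists (H : phase R -> phase R) (U W : R -> set (phase R))
         (Phi Psi : R -> phase R -> phase R) (Fbar : phase R -> phase R),
    [/\ near_identity H U W Phi Psi,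
        has_expansion (resonant omega0 Omega0) f Fbar &
        O_eps2 (fun e ubar =>
          pushforward_field (Phi e) (Psi e)
            (fun u => L0 omega0 Omega0 u + e *: F u + Rem e u) ubar
          - (L0 omega0 Omega0 ubar + e *: Fbar ubar))].
Proof.
pose H := homological_field omega0 Omega0 f.
pose Fbar := averaged_field omega0 Omega0 f.
have [sH lH pH] : regular H by exact: regular_trig_field.
have [_ lB _] : regular Fbar by exact: regular_trig_field.
have [_ lF _] : regular F.
  have -> : F = field_of (fun j =>
      trig_poly (finmap.enum_fset (fset_set [set alpha | f j alpha != 0])) (f j)).
    apply/funext => u; apply/esym/field_ofE => j.
    rewrite F_expansion (trig_poly_fsbig f_finite (fun=> setT)).
    by apply: eq_bigr => alpha _; rewrite ifT// in_setT.
  exact: regular_trig_field.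
have [U [W [Psi [niH PsiK]]]] := near_identity_exists sH pH lH.
exists H, U, W, (fun e u => u + e *: H u), Psi, Fbar; split=> //.
  exact: averaged_expansion.
move=> K cK; have [r rP] := PsiK K cK; have [N KN] := compact_norm_le cK.
(* One strip for both u = Psi_e(v) and v; the [+ 1] puts u in its interior, where the Lipschitz
   constant of H bounds the differential. *)
pose rho := Num.max r N%:R + 1.
have [LH /strip_bound_norm[Hb HL]] := lH rho.
have [LF /strip_bound_norm[Fb _]] := lF rho.
have [LB /strip_bound_norm[_ BL]] := lB rho.
(* [Rem] is evaluated at Psi_e(v) rather than at v, so its bound is taken on a compact set
   containing all these points. *)
have [B cB Br] := @compact_norm_ball R r.
have [C RemC] := Rem_O B cB.
(* One summand per term of [pushforward_perturbed], in the same order; the second uses |u - v| <=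
   |LH| e. *)
exists (`|C| + `|LB| * `|LH| + `|LH| * `|LF| + `|LH| * `|C|).
near=> e => v Kv.
have e0 : 0 < e by near: e; exact: nbhs_right_gt.
have e1 : e <= 1 by near: e; exact: nbhs_right_le.
have [ur uv] : `|Psi e v| <= r /\ Psi e v + e *: H (Psi e v) = v.
  by move: v Kv; near: e.
have RC : `|Rem e (Psi e v)| <= `|C| * e ^+ 2.
  have Re : forall u, B u -> `|Rem e u| <= C * e ^+ 2 by near: e.
  apply: le_trans (Re _ (Br _ ur)) _.
  by rewrite ler_wpM2r ?ler_norm// exprn_ge0// ltW.
have dH : differentiable H (Psi e v) by exact: (sH 1%N).1.
have hom : F (Psi e v) + 'd H (Psi e v) (L0 omega0 Omega0 (Psi e v))
    - L0lin omega0 (H (Psi e v)) = Fbar (Psi e v).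
  exact: homological_equation.
rewrite (pushforward_perturbed (Rem e) erefl dH uv hom).
set u := Psi e v in ur uv RC dH hom *.
have su : open_strip rho u.
  apply: open_strip_norm; apply: le_lt_trans ur _.
  by rewrite ltr_pwDr// le_max lexx.
have sv : strip rho v.
  apply: strip_norm; apply: le_trans (KN v Kv) _.
  by rewrite ler_wpDr// le_max lexx orbT.
have dHL h : `|'d H u h| <= `|LH| * `|h|.
  apply: diff_norm_le => //.
  apply: filterS (open_nbhs_nbhs (conj (@open_open_strip R rho) su)) => y sy.
  by apply: HL; exact: open_strip_sub.
have suv : `|u - v| <= `|LH| * e.
  rewrite -{1}uv opprD addrA subrr add0r normrN normrZ gtr0_norm// mulrC.
  by apply: ler_wpM2r; [exact: ltW|apply: Hb; exact: open_strip_sub].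
have e2 : 0 <= e ^+ 2 by rewrite exprn_ge0// ltW.
rewrite !mulrDl; apply: le_trans (ler_normD _ _) _; apply: lerD.
  apply: le_trans (ler_normD _ _) _; apply: lerD.
    apply: le_trans (ler_normD _ _) _; apply: lerD => //.
    rewrite normrZ gtr0_norm//.
    have BLuv := BL _ _ (open_strip_sub su) sv.
    apply: le_trans (ler_wpM2l (ltW e0) BLuv) _.
    apply: le_trans (ler_wpM2l (ltW e0) (ler_wpM2l (normr_ge0 LB) suv)) _.
    by rewrite le_eqVlt; apply/orP; left; apply/eqP; ring.
  rewrite normrZ ger0_norm// mulrC ler_wpM2r//.
  apply: le_trans (dHL _) _; apply: ler_wpM2l => //.
  by apply: Fb; exact: open_strip_sub.
rewrite normrZ gtr0_norm//.
(* This term is of order e^3; the surplus factor is absorbed by e <= 1. *)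
apply: le_trans (_ : 1 * (`|LH| * (`|C| * e ^+ 2)) <= _); last first.
  by rewrite mul1r mulrA.
apply: (ler_pM (ltW e0) (normr_ge0 _) e1).
by apply: le_trans (dHL _) _; apply: ler_wpM2l.
Unshelve. all: by end_near. Qed.
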